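(* Let $L$ be a $\mathrm{gl}$-regular Nijenhuis operator in a neighbourhood of a point $\mathsf p$ of an $n$-dimensional manifold with local coordinates $u=(u^1,\dots,u^n)$. Consider the PDE system for $u(x,t_1,\dots,t_{n-1})$ $$u_{t_i}=A_iu_x,\qquad i=1,\dots,n-1,\qquad(\ast)$$ where $\det(\lambda\,\mathrm{Id}-L)=\lambda^n-\sigma_1\lambda^{n-1}-\dots-\sigma_n$ and $A_0=\mathrm{Id}$, $A_{i+1}=LA_i-\sigma_{i+1}\mathrm{Id}$. Choose an initial condition $u(x,0,\dots,0)=\gamma(x)$, where $\gamma$ is a curve such that $\gamma'(x)$ is a cyclic vector for $L$ (at $\gamma(x)$) and $\gamma(0)=\mathsf p$. Assume there exists a regular hierarchy $\mathrm{d}g_1,\dots,\mathrm{d}g_n$ of conservation laws of $L$ such that $g_n(\gamma(x))=x$ and $g_i(\gamma(x))=0$ for $i=1,\dots,n-1$. Then: (a) The solution of $(\ast)$ with the prescribed initial condition (for $(x,t_1,\dots,t_{n-1})$ near $0$) can be obtained by solving the system of equations $$g_1(u)=t_{n-1},\quad g_2(u)=t_{n-2},\quad\dots,\quad g_{n-1}(u)=t_1,\quad g_n(u)=x$$ with respect to $u=(u^1,\dots,u^n)$. (b) The required hierarchy $g_1,\dots,g_n$ can be obtained by the following procedure. Take an arbitrary regular hierarchy $\mathrm{d}f_1,\dots,\mathrm{d}f_n$ of conservation laws of $L$. At every point of the curve let $\xi(x)\in T_{\gamma(x)}$ be the vector uniquely defined by $\mathrm{d}f_i(\gamma(x))(\xi(x))=0$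 for $i=1,\dots,n-1$ and $\mathrm{d}f_n(\gamma(x))(\xi(x))=1$, and let $\widehat M(\gamma(x))$ be the (unique) operator that commutes with $L(\gamma(x))$ and satisfies $\widehat M(\gamma(x))\gamma'(x)=\xi(x)$. Then there is a symmetry $M$ of $L$ whose restriction to the curve $\gamma$ coincides with $\widehat M(\gamma(x))$; for such $M$ the 1-forms $M^*\mathrm{d}f_i$ are closed, and the functions $g_i$ determined by $\mathrm{d}g_i=M^*\mathrm{d}f_i$, $g_i(\mathsf p)=0$, form a required hierarchy, i.e. $\mathrm{d}g_1,\dots,\mathrm{d}g_n$ is a regular hierarchy of conservation laws of $L$ with $g_n(\gamma(x))=x$ and $g_i(\gamma(x))=0$ for $i=1,\dots,n-1$.
   Context: An operator field is a field of endomorphisms of the tangent bundle. All objects are smooth (the statement holds equally with everything real analytic), and all statements are local near $\mathsf p$ and near $x=t_1=\dots=t_{n-1}=0$ (neighbourhoods may be shrunk). For a 1-form $\alpha$, $(L^*\alpha)(\xi)=\alpha(L\xi)$. Nijenhuis operator: an operator field $L$ with $L^2[\xi,\eta]-L[L\xi,\eta]-L[\xi,L\eta]+[L\xi,L\eta]=0$ for all vector fields $\xi,\eta$. A tangent vector $\xi$ is cyclic for $L$ if $\xi,L\xi,\dots,L^{n-1}\xi$ are linearly independent; $L$ is $\mathrm{gl}$-regular if it admits a cyclic vector at every point. In $(\ast)$, $u_x$ and $u_{t_i}$ are the column vectors of partial derivatives and $A_i=A_i(u)$ is the matrix of the operator field at the point $u$. Symmetry: for commuting operator fields $L,M$ put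 $\langle L,M\rangle(\xi,\eta)=M[L\xi,\eta]+L[\xi,M\eta]-[L\xi,M\eta]-LM[\xi,\eta]$; $M$ is a symmetry of $L$ if $LM=ML$ and $\langle L,M\rangle(\xi,\xi)=0$ for all vector fields $\xi$. Conservation law of $L$: a closed 1-form $\mathrm{d}f$ with $\mathrm{d}(L^*\mathrm{d}f)=0$. A hierarchy of conservation laws of $L$ is a sequence $\mathrm{d}f_1,\dots,\mathrm{d}f_n$ with $\mathrm{d}f_1$ a conservation law of $L$ and $L^*\mathrm{d}f_i=\mathrm{d}f_{i+1}$, $i=1,\dots,n-1$; it is regular if $\mathrm{d}f_1,\dots,\mathrm{d}f_n$ are linearly independent at each point. *)

(* Defs.v *)
From HB Require Import structures.
From mathcomp Require Import all_boot all_order all_algebra.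
From mathcomp Require Import all_classical all_reals all_analysis.
Set Implicit Arguments.
Unset Strict Implicit.
Unset Printing Implicit Defensive.
Import Order.TTheory GRing.Theory Num.Theory.
Import numFieldNormedType.Exports.
Local Open Scope classical_set_scope.
Local Open Scope ring_scope.

(* Everything is written in a chart: points and tangent vectors are columns
   'cV[R]_n.+1, 1-forms take values in rows 'rV[R]_n.+1, operator fields take
   values in 'M[R]_n.+1.  The dimension is N = n.+1; indices are shifted by one:
   the k-th object of the mathematical text has ordinal index k - 1. *)

(* f is C^k on the (open) set A: all iterated directional derivatives of order
   at most k exist and are continuous on A. *)
Fixpoint Ck (R : realType) (E F : normedModType R) (k : nat) (A : set E)
    (f : E -> F) : Prop :=
  (forall x, A x -> {for x, continuous f}) /\
  (if k is k'.+1 then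
     forall v : E, (forall x, A x -> derivable f x v) /\
                   Ck k' A (fun x => 'D_v f x)
   else True).

Definition smooth_on (R : realType) (E F : normedModType R) (A : set E)
    (f : E -> F) : Prop :=
  forall k, Ck k A f.

Section Fields.
Variables (R : realType) (n : nat).
Local Notation E := 'cV[R]_n.+1.
Local Notation Op := 'M[R]_n.+1.
Implicit Types (U : set E) (L M : E -> Op) (xi eta : E -> E).

Definition evec (i : 'I_n.+1) : E := delta_mx i 0.

Definition lie xi eta : E -> E :=
  fun u => 'D_(xi u) eta u - 'D_(eta u) xi u.

Definition app L xi : E -> E := fun u => L u *m xi u.

Definition opmul L M : E -> Op := fun u => L u *m M u.

Definition dform (f : E -> R^o) : E -> 'rV[R]_n.+1 :=
  fun u => \row_j 'D_(evec j) f u.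

(* (L^* alpha)(xi) = alpha (L xi) *)
Definition pull L (alpha : E -> 'rV[R]_n.+1) : E -> 'rV[R]_n.+1 :=
  fun u => alpha u *m L u.

Definition closed_form U (alpha : E -> 'rV[R]_n.+1) : Prop :=
  forall u, U u -> forall i j : 'I_n.+1,
    'D_(evec i) (fun v => alpha v 0 j : R^o) u =
    'D_(evec j) (fun v => alpha v 0 i : R^o) u.

Definition nijenhuis U L : Prop :=
  smooth_on U L /\
  forall xi eta, smooth_on U xi -> smooth_on U eta -> forall u, U u ->
    app (opmul L L) (lie xi eta) u - app L (lie (app L xi) eta) u
      - app L (lie xi (app L eta)) u + lie (app L xi) (app L eta) u = 0.

(* v, A v, ..., A^(dim - 1) v are linearly independent *)
Definition cyclic_vector (A : Op) (v : E) : Prop :=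
  row_free (\matrix_(i < n.+1) (A ^+ i *m v)^T).

Definition gl_regular U L : Prop :=
  forall u, U u -> exists v, cyclic_vector (L u) v.

Definition bracket L M xi eta : E -> E := fun u =>
  app M (lie (app L xi) eta) u + app L (lie xi (app M eta)) u
    - lie (app L xi) (app M eta) u - app (opmul L M) (lie xi eta) u.

Definition symmetry U L M : Prop :=
  [/\ smooth_on U M,
      forall u, U u -> L u *m M u = M u *m L u &
      forall xi, smooth_on U xi -> forall u, U u -> bracket L M xi xi u = 0].

Definition conservation_law U L (f : E -> R^o) : Prop :=
  smooth_on U f /\ closed_form U (pull L (dform f)).

(* A hierarchy df_1, ..., df_N is given by potentials f. *)
Definition hierarchy U L (f : 'I_n.+1 -> E -> R^o) : Prop :=
  [/\ conservation_law U L (f ord0),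
      forall i, smooth_on U (f i) &
      forall i j : 'I_n.+1, j = i.+1 :> nat ->
        forall u, U u -> pull L (dform (f i)) u = dform (f j) u].

Definition regular_hierarchy U L (f : 'I_n.+1 -> E -> R^o) : Prop :=
  hierarchy U L f /\
  forall u, U u -> row_free (\matrix_(i < n.+1) dform (f i) u).

(* sigma A k is the sigma_k of
   det (X Id - A) = X^N - sigma_1 X^(N-1) - ... - sigma_N. *)
Definition sigma (A : Op) (k : nat) : R := - (char_poly A)`_(n.+1 - k).

Fixpoint Acoef (A : Op) (i : nat) : Op :=
  if i is j.+1 then A *m Acoef A j - (sigma A j.+1)%:M else 1%:M.

(* The independent variables (x, t_1, ..., t_n) form one column y, with
   y_0 = x and y_i = t_i for i > 0. *)
Definition solves_system (W U : set E) L (u : E -> E) : Prop :=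
  [/\ smooth_on W u,
      forall y, W y -> U (u y) &
      forall y, W y -> forall i : 'I_n.+1, (0 < i)%N ->
        'D_(evec i) u y = Acoef (L (u y)) i *m 'D_(evec ord0) u y].

(* g_1 = t_(N-1), g_2 = t_(N-2), ..., g_(N-1) = t_1, g_N = x at v *)
Definition hodograph (g : 'I_n.+1 -> E -> R^o) (y v : E) : Prop :=
  forall i, g i v = y (rev_ord i) 0.

(* g_N (gamma x) = x and g_i (gamma x) = 0 for i < N *)
Definition normalized_at (g : 'I_n.+1 -> E -> R^o) (gamma : R^o -> E)
    (x : R) : Prop :=
  g ord_max (gamma x) = x /\
  forall i : 'I_n.+1, (i < n)%N -> g i (gamma x) = 0.

Definition xi_spec (f : 'I_n.+1 -> E -> R^o) (pt v : E) : Prop :=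
  (forall i : 'I_n.+1, (i < n)%N -> dform (f i) pt *m v = 0) /\
  dform (f ord_max) pt *m v = 1%:M.

Definition Mhat_spec (A : Op) (w v : E) (B : Op) : Prop :=
  B *m A = A *m B /\ B *m w = v.

End Fields.

(* Main.v *)
(* Let G be the matrix with rows dg_i. By Cayley-Hamilton G L = C G with C the
   companion matrix of L, and reading off the columns of C, the operators A_j
   send the vector dual to dg_n to the one dual to dg_(n-j). The inverse function
   theorem inverts the map (g_n, ..., g_1), and the partial derivatives of the
   inverse are exactly these dual vectors: this is the system (a).

   For (b), when L and M commute, <L, M>(xi, xi) is tensorial in xi and
   d(M^* alpha)(L v, v) = - alpha (<L, M>(v, v)) as soon as alpha and L^* alpha
   are closed. Hence M is a symmetry if M preserves closedness along a frame of
   conservation laws; conversely, if M is a symmetry then L is self-adjoint for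
   the 2-form d(M^* alpha), which must vanish since L has a cyclic vector.
   With F the matrix with rows df_i, the symmetry is M = F^-1 G, which is defined
   on the whole domain, commutes with L because F and G intertwine L with the
   same C, and satisfies M^* df_i = dg_i. For an arbitrary symmetry M agreeing
   with it along gamma, the g_i are obtained by the Poincare lemma and normalized
   by integrating dg_i along gamma. *)
Require Import Defs.
From HB Require Import structures.
From mathcomp Require Import all_boot all_order all_algebra.
From mathcomp Require Import all_classical all_reals all_analysis.
From mathcomp Require Import perm ring lra.
Set Implicit Arguments.
Unset Strict Implicit.
Unset Printing Implicit Defensive.
Import Order.TTheory GRing.Theory Num.Theory.
Import numFieldNormedType.Exports.
Local Open Scope classical_set_scope.
Local Open Scope ring_scope.

(** * Directional derivatives *)

(** Smoothness here means existence and continuity of iterated directional derivatives. Total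
    differentiability, the symmetry of second derivatives, the inverse function theorem and the
    Poincare lemma therefore have to be obtained from that definition; the common tool is
    restriction to a line, where the one-variable mean value theorem applies. The two frames share
    one companion matrix because a hierarchy satisfies [dg_i = dg_1 L^(i-1)]: all rows but the last
    are shifts, and the last one involves only the characteristic polynomial of [L]. So the symmetry
    in (b) is found by linear algebra from [df] and [dg], without integrating an equation for [M].
    The Nijenhuis identity enters through one fact: if [alpha] and [L^* alpha] are closed, so is
    [L^* L^* alpha]. It is what controls the last form of a hierarchy, which has no successor. *)

Section DirectionalCalculus.
Context {R : realType}.
Implicit Types (V W : normedModType R).

Lemma is_derive_line V W (f : V -> W) (a v : V) (t : R) (df : W) :
  is_derive (a + t *: v) v f df ->
  is_derive (t : R^o) 1 (fun s : R^o => f (a + s *: v)) df.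
Proof.
move=> [fd fE].
have E : (fun h : R => h^-1 *: (f (a + (h *: (1 : R^o) + t) *: v) - f (a + t *: v)))
       = (fun h : R => h^-1 *: (f (h *: v + (a + t *: v)) - f (a + t *: v))).
  by apply: funext => h; rewrite scalerDl [h *: (1 : R^o)]mulr1 addrCA.
by split; rewrite ?/derivable /derive /= E.
Qed.

(** Homogeneity in the direction holds without total differentiability of [f]: on the line through
    [x] along [v], one-variable derivability already is differentiability. The case [s = 0] is
    included. *)
Lemma is_derive_scale V W (f : V -> W) (x v : V) (df : W) (s : R) :
  is_derive x v f df -> is_derive x (s *: v) f (s *: df).
Proof.
move=> fd.
pose c := fun t : R^o => f (x + t *: v).
have cd : is_derive (0 : R^o) 1 c df.
  by apply: is_derive_line; rewrite scale0r addr0.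
have cdf : differentiable c 0 by apply/derivable1_diffP; case: cd.
have fc : (fun h : R => h^-1 *: (f (h *: (s *: v) + x) - f x))
        = (fun h : R => h^-1 *: (c (h *: (s : R^o) + 0) - c 0)).
  by apply: funext => h; rewrite /c scale0r !addr0 scalerA (addrC x).
split; first by rewrite /derivable fc; apply: diff_derivable.
rewrite /derive fc -/(derive c 0 s) deriveE // -[s in LHS]mulr1 linearZ /=.
by rewrite -deriveE // derive_val.
Qed.

(** Only the outer map is assumed differentiable. The inner one is replaced by the curve
    [t |-> u (y + t *: v)], which is differentiable at 0 because its parameter is
    one-dimensional. *)
Lemma is_derive_comp V (E F : normedModType R) (u : V -> E) (f : E -> F)
    (y v : V) (du : E) :
  differentiable f (u y) -> is_derive y v u du ->
  is_derive y v (f \o u) ('d f (u y) du).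
Proof.
move=> fd ud.
pose c := fun t : R^o => u (y + t *: v).
have c0 : c 0 = u y by rewrite /c scale0r addr0.
have cd : is_derive (0 : R^o) 1 c du.
  by apply: is_derive_line; rewrite scale0r addr0.
have cdf : differentiable c 0 by apply/derivable1_diffP; case: cd.
have fcd : differentiable f (c 0) by rewrite c0.
have fcdf : differentiable (f \o c) 0 by apply: differentiable_comp.
have fuE h : (f \o u) (h *: v + y) = (f \o c) (h *: (1 : R^o) + 0).
  by rewrite /c /= addr0 [h *: (1 : R^o)]mulr1 addrC.
have fuE0 : (f \o u) y = (f \o c) 0 by rewrite /= c0.
have EE : (fun h : R => h^-1 *: ((f \o u) (h *: v + y) - (f \o u) y))
       = (fun h : R => h^-1 *: ((f \o c) (h *: (1 : R^o) + 0) - (f \o c) 0)).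
  by apply: funext => h; rewrite fuE fuE0.
split.
  by rewrite /derivable EE; apply: diff_derivable.
rewrite /derive EE -/(derive (f \o c) 0 1) deriveE // diff_comp //=.
by rewrite c0 -[X in 'd f _ X](deriveE _ cdf) (@derive_val _ _ _ _ _ _ _ cd).
Qed.

Lemma is_derive_near V W (f g : V -> W) (A : set V) (x v : V) df :
  open A -> A x -> (forall y, A y -> f y = g y) ->
  is_derive x v f df -> is_derive x v g df.
Proof.
move=> Ao Ax fg; apply: near_eq_is_derive.
by apply: filterS (open_nbhs_nbhs (conj Ao Ax)).
Qed.

Lemma derive_near V W (f g : V -> W) (A : set V) (x v : V) :
  open A -> A x -> (forall y, A y -> f y = g y) -> 'D_v f x = 'D_v g x.
Proof.
move=> Ao Ax fg; apply: near_eq_derive.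
by apply: filterS (open_nbhs_nbhs (conj Ao Ax)).
Qed.

Lemma is_derive_mulr V (f g : V -> R^o) (x v : V) (df dg : R^o) :
  is_derive x v f df -> is_derive x v g dg ->
  is_derive x v (fun y => f y * g y : R^o) (df * g x + f x * dg : R^o).
Proof.
move=> Hf Hg; have [fd fE] := Hf; have [gd gE] := Hg.
split; first exact: derivableM.
by rewrite deriveM // fE gE addrC [g x *: _]mulrC.
Qed.

Lemma is_derive_sumr V W (I : Type) (r : seq I) (F : I -> V -> W)
    (x v : V) (dF : I -> W) :
  (forall i, is_derive x v (F i) (dF i)) ->
  is_derive x v (fun y => \sum_(i <- r) F i y) (\sum_(i <- r) dF i).
Proof.
move=> H; elim: r => [|a r IH].
  rewrite big_nil; under eq_fun do rewrite big_nil; exact: is_derive_cst.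
by rewrite big_cons; under eq_fun do rewrite big_cons; apply: is_deriveD.
Qed.

Lemma is_derive_mx V m n (M : V -> 'M[R]_(m, n)) (x v : V) (dM : 'M[R]_(m, n)) :
  is_derive x v M dM <->
  (forall i j, is_derive x v (fun y => M y i j : R^o) (dM i j : R^o)).
Proof.
split=> [[Md ME] i j|H].
  split; first exact: ((derivable_mxP M x v).1 Md).
  by rewrite -ME derive_mx // mxE.
have Md : derivable M x v by apply/derivable_mxP => i j; case: (H i j).
by split=> //; apply/matrixP => i j; rewrite derive_mx // mxE; case: (H i j).
Qed.

Lemma is_derive_mulmx V m n p (M : V -> 'M[R]_(m, n)) (N : V -> 'M[R]_(n, p))
    (x v : V) dM dN :
  is_derive x v M dM -> is_derive x v N dN ->
  is_derive x v (fun y => M y *m N y) (dM *m N x + M x *m dN).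
Proof.
move=> /is_derive_mx HM /is_derive_mx HN; apply/is_derive_mx => i j.
under eq_fun do rewrite mxE.
rewrite !mxE -big_split /=.
by apply: is_derive_sumr => k; apply: is_derive_mulr.
Qed.

(** The parameter runs over [0, 1] and is multiplied by [s], so that one statement covers every sign
    of [s], and also [s = 0]. *)
Lemma MVT_line V (f : V -> R^o) (df : V -> R^o) (a v : V) (s : R) :
  (forall t, 0 <= t <= 1 ->
     is_derive (a + (t * s) *: v) v f (df (a + (t * s) *: v))) ->
  exists2 t, 0 <= t <= 1 & f (a + s *: v) - f a = s * df (a + (t * s) *: v).
Proof.
move=> H.
have H1 t : 0 <= t <= 1 ->
    is_derive (t : R^o) 1 (fun t : R^o => f (a + (t * s) *: v))
      (s * df (a + (t * s) *: v)).
  move=> /H /(is_derive_scale s).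
  rewrite -scalerA => /is_derive_line.
  by under eq_fun do rewrite scalerA.
have [||t t01 E] := @MVT_segment R (fun t : R^o => f (a + (t * s) *: v))
    (fun t => s * df (a + (t * s) *: v)) 0 1 ler01.
- by move=> t /andP[t0 t1]; apply: H1; rewrite !ltW.
- apply: derivable_within_continuous => t; rewrite in_itv /= => t01.
  by case: (H1 _ t01).
exists t; first by move: t01; rewrite in_itv.
by move: E; rewrite mul1r mul0r scale0r addr0 subr0 mulr1.
Qed.

End DirectionalCalculus.

(** * Calculus of C^k maps *)

Section CkTheory.
Context {R : realType}.
Implicit Types (V W : normedModType R).

Lemma Ck_continuous V W k (A : set V) (f : V -> W) x :
  Ck k A f -> A x -> {for x, continuous f}.
Proof. by case: k => [|k] [fc _] Ax; exact: fc. Qed.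

Lemma Ck_derivable V W k (A : set V) (f : V -> W) x v :
  Ck k.+1 A f -> A x -> is_derive x v f ('D_v f x).
Proof. by move=> [_ /(_ v) [fd _]] Ax; apply/derivableP/fd. Qed.

Lemma Ck_derive V W k (A : set V) (f : V -> W) v :
  Ck k.+1 A f -> Ck k A (fun x => 'D_v f x).
Proof. by move=> [_ /(_ v) []]. Qed.

Lemma CkS V W k (A : set V) (f : V -> W) : Ck k.+1 A f -> Ck k A f.
Proof.
elim: k f => [|k IH] f [fc fD]; split=> // v; have [fd fDk] := fD v.
by split=> //; apply: IH.
Qed.

Lemma Ck_subset V W k (A B : set V) (f : V -> W) :
  B `<=` A -> Ck k A f -> Ck k B f.
Proof.
move=> BA; elim: k f => [|k IH] f [fc fD].
  by split=> // x /BA; exact: fc.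
split=> [x /BA|v]; first exact: fc.
by have [fd fDk] := fD v; split; [move=> x /BA; exact: fd|exact: IH].
Qed.

Lemma Ck_ext V W k (A : set V) (f g : V -> W) :
  open A -> (forall x, A x -> f x = g x) -> Ck k A f -> Ck k A g.
Proof.
move=> Ao; elim: k f g => [|k IH] f g fg [fc fD].
  split=> // x Ax; have fx := fc x Ax.
  rewrite /prop_for /continuous_at -fg //; apply: cvg_trans fx.
  by apply: near_eq_cvg; apply: filterS (open_nbhs_nbhs (conj Ao Ax)).
split=> [x Ax|v].
  have fx := fc x Ax.
  rewrite /prop_for /continuous_at -fg //; apply: cvg_trans fx.
  by apply: near_eq_cvg; apply: filterS (open_nbhs_nbhs (conj Ao Ax)).
have [fd fDk] := fD v; split.
  move=> x Ax; have := derivableP (fd x Ax).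
  by move/(is_derive_near Ao Ax fg) => [].
apply: IH fDk => x Ax; exact: derive_near fg.
Qed.

Lemma smooth_ext V W (A : set V) (f g : V -> W) :
  open A -> (forall x, A x -> f x = g x) -> smooth_on A f -> smooth_on A g.
Proof. by move=> Ao fg fS k; apply: (Ck_ext Ao fg). Qed.

Lemma smooth_subset V W (A B : set V) (f : V -> W) :
  B `<=` A -> smooth_on A f -> smooth_on B f.
Proof. by move=> BA fS k; apply: (Ck_subset BA). Qed.

Lemma smooth_derive V W (A : set V) (f : V -> W) v :
  smooth_on A f -> smooth_on A (fun x => 'D_v f x).
Proof. by move=> fS k; apply: Ck_derive. Qed.

Lemma smooth_continuous V W (A : set V) (f : V -> W) x :
  smooth_on A f -> A x -> {for x, continuous f}.
Proof. by move=> /(_ 0) /Ck_continuous; apply. Qed.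

Lemma smooth_derivable V W (A : set V) (f : V -> W) x v :
  smooth_on A f -> A x -> is_derive x v f ('D_v f x).
Proof. by move=> /(_ 1) /Ck_derivable; apply. Qed.

Lemma smooth_of_derive V W (A : set V) (f : V -> W) :
  (forall x, A x -> {for x, continuous f}) ->
  (forall x v, A x -> derivable f x v) ->
  (forall v, smooth_on A (fun x => 'D_v f x)) -> smooth_on A f.
Proof. by move=> fc fd fD [|k]; split=> // v; split=> [x|]; auto; exact: fD. Qed.

Lemma Ck_cst V W k (A : set V) (c : W) : Ck k A (fun=> c).
Proof.
elim: k c => [|k IH] c; first by split=> // x _; exact: cvg_cst.
split=> [x _|v]; first exact: cvg_cst.
split=> [x _|]; first exact: derivable_cst.
have -> : (fun x => 'D_v (fun=> c) x) = (fun=> 0 : W).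
  by apply: funext => x; exact: derive_cst.
exact: IH.
Qed.

Lemma CkD V W k (A : set V) (f g : V -> W) : open A ->
  Ck k A f -> Ck k A g -> Ck k A (fun x => f x + g x).
Proof.
move=> Ao; elim: k f g => [|k IH] f g Hf Hg.
  split=> // x Ax; apply: cvgD.
    exact: (Ck_continuous Hf Ax).
  exact: (Ck_continuous Hg Ax).
have D x v : A x -> is_derive x v (fun x => f x + g x) ('D_v f x + 'D_v g x).
  move=> Ax; have := Ck_derivable v Hf Ax; have := Ck_derivable v Hg Ax.
  by move=> ? ?; exact: is_deriveD.
split=> [x Ax|v].
  exact: (Ck_continuous (IH f g (CkS Hf) (CkS Hg)) Ax).
split=> [x Ax|]; first by case: (D x v Ax).
apply: Ck_ext Ao _ (IH _ _ (Ck_derive v Hf) (Ck_derive v Hg)) => x Ax.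
by case: (D x v Ax) => _ ->.
Qed.

Lemma CkM V k (A : set V) (f g : V -> R^o) : open A ->
  Ck k A f -> Ck k A g -> Ck k A (fun x => f x * g x : R^o).
Proof.
move=> Ao; elim: k f g => [|k IH] f g Hf Hg.
  split=> // x Ax; apply: (@cvgM R).
    exact: (Ck_continuous Hf Ax).
  exact: (Ck_continuous Hg Ax).
have D x v : A x ->
    is_derive x v (fun x => f x * g x : R^o) ('D_v f x * g x + f x * 'D_v g x).
  by move=> Ax; apply: is_derive_mulr; apply: Ck_derivable Ax; eassumption.
split=> [x Ax|v].
  exact: (Ck_continuous (IH f g (CkS Hf) (CkS Hg)) Ax).
split=> [x Ax|]; first by case: (D x v Ax).
have C := CkD Ao (IH _ _ (Ck_derive v Hf) (CkS Hg))
                 (IH _ _ (CkS Hf) (Ck_derive v Hg)).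
by apply: Ck_ext Ao _ C => x Ax; case: (D x v Ax) => _ ->.
Qed.

Lemma CkV V k (A : set V) (f : V -> R^o) : open A ->
  (forall x, A x -> f x != 0) -> Ck k A f -> Ck k A (fun x => (f x)^-1 : R^o).
Proof.
move=> Ao f0; elim: k => [|k IH] Hf.
  by split=> // x Ax; apply: (@cvgV R); [exact: f0|exact: (Ck_continuous Hf Ax)].
have D x v : A x -> is_derive x v (fun x => (f x)^-1 : R^o)
    (- 1 * ('D_v f x * ((f x)^-1 * (f x)^-1))).
  move=> Ax; have [fd _] := Ck_derivable v Hf Ax.
  split; first by apply: derivableV => //; exact: f0.
  rewrite deriveV ?f0 // mulN1r scaleNr; congr (- _).
  by rewrite [LHS]mulrC -invfM.
have C := IH (CkS Hf).
split=> [x Ax|v]; first exact: (Ck_continuous C).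
split=> [x Ax|]; first by case: (D x v Ax).
have C1 := CkM Ao (Ck_derive v Hf) (CkM Ao C C).
apply: Ck_ext Ao _ (CkM Ao (@Ck_cst V R^o k A (-1)) C1) => x Ax.
by case: (D x v Ax) => _ ->.
Qed.

Lemma Ck_sum V W k (A : set V) (I : Type) (r : seq I) (F : I -> V -> W) :
  open A -> (forall i, Ck k A (F i)) -> Ck k A (fun x => \sum_(i <- r) F i x).
Proof.
move=> Ao HF; elim: r => [|a r IH].
  by under eq_fun do rewrite big_nil; exact: Ck_cst.
by under eq_fun do rewrite big_cons; exact: CkD.
Qed.

Lemma Ck_prod V k (A : set V) (I : Type) (r : seq I) (F : I -> V -> R^o) :
  open A -> (forall i, Ck k A (F i)) ->
  Ck k A (fun x => \prod_(i <- r) F i x : R^o).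
Proof.
move=> Ao HF; elim: r => [|a r IH].
  by under eq_fun do rewrite big_nil; exact: Ck_cst.
by under eq_fun do rewrite big_cons; exact: CkM.
Qed.

Lemma mx_continuous_at V m n (M : V -> 'M[R]_(m, n)) x :
  (forall i j, {for x, continuous (fun y => M y i j : R^o)}) ->
  {for x, continuous M}.
Proof.
move=> H; apply/cvgrPdist_le => /= e e0; near=> y.
rewrite /Num.Def.normr /= mx_normrE (bigmax_le _ (ltW e0)) //= => i _.
rewrite !mxE /=; move: i; near: y; apply: filter_forall => /= i.
exact: ((cvgrPdist_le _ _).1 (H i.1 i.2) _ e0).
Unshelve. all: by end_near. Qed.

Lemma Ck_mx V k m n (A : set V) (M : V -> 'M[R]_(m, n)) : open A ->
  Ck k A M <-> (forall i j, Ck k A (fun x => M x i j : R^o)).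
Proof.
move=> Ao; elim: k M => [|k IH] M; split.
- move=> [Mc _] i j; split=> // x /Mc Mx.
  apply: (continuous_comp (g := fun N : 'M[R]_(m, n) => N i j : R^o)).
    exact: Mx.
  exact: coord_continuous.
- move=> H; split=> // x Ax; apply: mx_continuous_at => i j.
  exact: (Ck_continuous (H i j)).
- move=> HM i j; split=> [x Ax|v].
    apply: (continuous_comp (g := fun N : 'M[R]_(m, n) => N i j : R^o)).
      exact: (Ck_continuous HM).
    exact: coord_continuous.
  have D x : A x -> is_derive x v (fun x => M x i j : R^o) ('D_v M x i j).
    by move=> Ax; have /is_derive_mx := Ck_derivable v HM Ax; apply.
  split=> [x Ax|]; first by case: (D x Ax).
  apply: Ck_ext Ao _ ((IH _).1 (Ck_derive v HM) i j) => x Ax.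
  by case: (D x Ax).
- move=> H; split=> [x Ax|v].
    by apply: mx_continuous_at => i j; exact: (Ck_continuous (H i j)).
  have D x : A x ->
      is_derive x v M (\matrix_(i, j) 'D_v (fun x => M x i j : R^o) x).
    by move=> Ax; apply/is_derive_mx => i j; rewrite mxE; exact: Ck_derivable Ax.
  split=> [x Ax|]; first by case: (D x Ax).
  apply/IH => i j.
  apply: Ck_ext Ao _ (Ck_derive v (H i j)) => x Ax.
  by case: (D x Ax) => _ ->; rewrite mxE.
Qed.

Lemma smooth_mx V m n (A : set V) (M : V -> 'M[R]_(m, n)) : open A ->
  smooth_on A M <-> (forall i j, smooth_on A (fun x => M x i j : R^o)).
Proof.
move=> Ao; split=> [H i j k|H k]; first by have /Ck_mx := H k; apply.
by apply/Ck_mx => // i j; apply: H.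
Qed.

Lemma Ck_mulmx V k m n p (A : set V) (M : V -> 'M[R]_(m, n))
    (N : V -> 'M[R]_(n, p)) : open A ->
  Ck k A M -> Ck k A N -> Ck k A (fun x => M x *m N x).
Proof.
move=> Ao /Ck_mx HM /Ck_mx HN; apply/Ck_mx => // i j.
under eq_fun do rewrite mxE.
by apply: Ck_sum => // l; apply: CkM => //; [exact: HM|exact: HN].
Qed.

Lemma smooth_mulmx V m n p (A : set V) (M : V -> 'M[R]_(m, n))
    (N : V -> 'M[R]_(n, p)) : open A ->
  smooth_on A M -> smooth_on A N -> smooth_on A (fun x => M x *m N x).
Proof. by move=> Ao HM HN k; exact: Ck_mulmx. Qed.

Lemma Ck_det V k n (A : set V) (M : V -> 'M[R]_n) : open A ->
  Ck k A M -> Ck k A (fun x => \det (M x) : R^o).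
Proof.
move=> Ao /Ck_mx HM; apply: Ck_sum => // s; apply: CkM => //; first exact: Ck_cst.
by apply: Ck_prod => // i; exact: HM.
Qed.

Lemma Ck_invmx V k n (A : set V) (M : V -> 'M[R]_n) : open A ->
  (forall x, A x -> M x \in unitmx) ->
  Ck k A M -> Ck k A (fun x => invmx (M x)).
Proof.
move=> Ao Mu HM; apply/Ck_mx => // i j.
have C : Ck k A (fun x => (\det (M x))^-1 * cofactor (M x) j i : R^o).
  apply: CkM => //.
    apply: CkV => // [x /Mu|]; last exact: Ck_det.
    by rewrite unitmxE unitfE.
  apply: CkM => //; first exact: Ck_cst.
  apply: Ck_det => //; apply/Ck_mx => // i' j'.
  by under eq_fun do rewrite !mxE; have /Ck_mx := HM; apply.
apply: Ck_ext Ao _ C => x Ax.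
by rewrite /invmx Mu // !mxE.
Qed.

Lemma smooth_invmx V n (A : set V) (M : V -> 'M[R]_n) : open A ->
  (forall x, A x -> M x \in unitmx) ->
  smooth_on A M -> smooth_on A (fun x => invmx (M x)).
Proof. by move=> Ao Mu HM k; exact: Ck_invmx. Qed.

End CkTheory.

(** * C^1 functions are differentiable *)

Section Differentiability.
Context {R : realType}.

Lemma mx_norm_coord m n (M : 'M[R]_(m, n)) i j : `|M i j| <= `|M|.
Proof.
by rewrite [leRHS]/Num.Def.normr /= mx_normrE; exact: (le_bigmax _ _ (i, j)).
Qed.

Lemma mx_norm_le m n (M : 'M[R]_(m, n)) c :
  0 <= c -> (forall i j, `|M i j| <= c) -> `|M| <= c.
Proof.
move=> c0 H; rewrite /Num.Def.normr /= mx_normrE.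
by apply: bigmax_le => // i _; exact: H.
Qed.

Lemma differentiable_of_linear_approx (V W : normedModType R) (f : V -> W)
    (df : {linear V -> W}) x :
  continuous df ->
  (forall e, 0 < e ->
    \forall h \near 0, `|f (h + x) - f x - df h| <= e * `|h|) ->
  differentiable f x /\ 'd f x = df :> (V -> W).
Proof.
move=> dfc H.
have E : f \o shift x = cst (f x) + df +o_ 0 id.
  apply/eqaddoP => e e0; apply: filterS (H e e0) => h /=.
  by rewrite opprD addrA.
have dE := diff_unique dfc E.
by split=> //; apply/diff_locallyP; rewrite dE.
Qed.

Variable n : nat.
Implicit Types (A : set 'cV[R]_n) (f : 'cV[R]_n -> R^o).

Let e_ (j : 'I_n) : 'cV[R]_n := delta_mx j 0.

Definition grad f (x : 'cV[R]_n) : 'cV[R]_n -> R^o :=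
  fun h => \sum_j h j 0 * 'D_(e_ j) f x.

Lemma grad_is_linear f x : linear (grad f x).
Proof.
move=> a u v; rewrite /grad scaler_sumr -big_split /=.
by apply: eq_bigr => j _; rewrite !mxE mulrDl -mulrA.
Qed.

HB.instance Definition _ f x :=
  GRing.isLinear.Build R 'cV[R]_n R^o _ (grad f x) (grad_is_linear f x).

Lemma grad_continuous f x : continuous (grad f x).
Proof.
move=> h; suff C : Ck 0 setT (grad f x) by exact: (Ck_continuous C).
apply: Ck_sum => [|j]; first exact: openT.
apply: CkM; [exact: openT| |exact: Ck_cst].
by split=> // y _; exact: coord_continuous.
Qed.

(* The broken line from [0] to [h] along the coordinate axes. *)
Let cut (h : 'cV[R]_n) (k : nat) : 'cV[R]_n :=
  \col_i (if (i < k)%N then h i 0 else 0).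

Let cut0 h : cut h 0 = 0.
Proof. by apply/matrixP => i j; rewrite !mxE. Qed.

Let cutn h : cut h n = h.
Proof. by apply/matrixP => i j; rewrite !mxE ltn_ord (ord1 j). Qed.

Let cutS h (k : 'I_n) : cut h k.+1 = cut h k + h k 0 *: e_ k.
Proof.
apply/matrixP => i j; rewrite !mxE (ord1 j) eqxx andbT ltnS leq_eqVlt.
by have [->|ne] := eqVneq i k; rewrite ?eqxx ?ltnn ?mulr1 ?add0r //=
  -[_ == _ :> nat]/(i == k) (negbTE ne) mulr0 addr0.
Qed.

Let cut_norm h (k : 'I_n) t : 0 <= t <= 1 ->
  `|cut h k + (t * h k 0) *: e_ k| <= `|h|.
Proof.
move=> /andP[t0 t1]; apply: mx_norm_le => // i j.
rewrite !mxE (ord1 j) eqxx andbT.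
have [->|ne] := eqVneq i k.
  rewrite ltnn add0r mulr1 normrM ger0_norm //.
  by rewrite (le_trans _ (mx_norm_coord h k 0)) // ler_piMl.
rewrite mulr0 addr0; case: ifP => _; first exact: mx_norm_coord.
by rewrite normr0.
Qed.

(** The increment of [f] is telescoped along the broken line [cut h]. By the mean value theorem each
    edge contributes [h k 0] times a partial derivative at a point within [|h|] of [x], and
    continuity compares it with the partial derivative at [x]. *)
Lemma C1_differentiable A f x : open A -> Ck 1 A f -> A x ->
  differentiable f x /\ 'd f x = grad f x :> (_ -> _).
Proof.
move=> Ao fC Ax; apply: differentiable_of_linear_approx.
  exact: grad_continuous.
move=> e e0.
(* There are [n] edges to share the error [e]; dividing by [n.+1] also covers dimension 0. *)
have e'0 : 0 < e / n.+1%:R by rewrite divr_gt0.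
have near_e : \forall y \near x, A y /\
    forall j, `|'D_(e_ j) f x - 'D_(e_ j) f y| <= e / n.+1%:R.
  near=> y; split; first by near: y; exact: open_nbhs_nbhs.
  near: y; apply: filter_forall => j.
  have := Ck_continuous (Ck_derive (e_ j) fC) Ax.
  by move/cvgrPdist_le; apply.
have [d /= d0 Hd] := (nbhs_ballP _ _).1 near_e.
near=> h.
have hd : `|h| < d by near: h; exact: (@nbhs0_lt R 'cV[R]_n).
have inA z : `|z| <= `|h| -> A (x + z) /\
    forall j, `|'D_(e_ j) f x - 'D_(e_ j) f (x + z)| <= e / n.+1%:R.
  move=> zh; apply: Hd; rewrite -ball_normE /= opprD addNKr normrN.
  exact: le_lt_trans zh hd.
have step (k : 'I_n) : `|f (x + cut h k.+1) - f (x + cut h k) -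
    h k 0 * 'D_(e_ k) f x| <= `|h| * (e / n.+1%:R).
  rewrite cutS addrA.
  have [t t01|t t01 ->] := @MVT_line R _ f (fun y => 'D_(e_ k) f y)
    (x + cut h k) (e_ k) (h k 0).
    apply: (Ck_derivable _ fC); rewrite -addrA.
    by apply: (proj1 (inA _ _)); exact: cut_norm.
  rewrite -mulrBr normrM -addrA distrC ler_pM //; first exact: mx_norm_coord.
  by apply: (proj2 (inA _ _)); exact: cut_norm.
have -> : f (h + x) - f x - grad f x h =
    \sum_(k < n) (f (x + cut h k.+1) - f (x + cut h k) - h k 0 * 'D_(e_ k) f x).
  rewrite sumrB; congr (_ - _).
  rewrite -(big_mkord xpredT (fun k => f (x + cut h k.+1) - f (x + cut h k))).
  rewrite (telescope_sumr (fun k => f (x + cut h k)) (leq0n n)).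
  by rewrite cutn cut0 addr0 (addrC x).
apply: le_trans (ler_norm_sum _ _ _) _.
apply: le_trans (ler_sum _ (fun k _ => step k)) _.
rewrite sumr_const card_ord -mulrnAr mulrC ler_wpM2r //.
rewrite -mulrnAl ler_pdivrMr ?ltr0n // -mulr_natr ler_pM2l // ler_nat.
exact: leqnSn.
Unshelve. all: by end_near. Qed.

Lemma smooth_differentiable A f x : open A -> smooth_on A f -> A x ->
  differentiable f x.
Proof. by move=> Ao fS Ax; have [] := C1_differentiable Ao (fS 1%N) Ax. Qed.

Lemma derive_grad A f x v : open A -> Ck 1 A f -> A x ->
  'D_v f x = grad f x v.
Proof.
move=> Ao fC Ax; have [fd <-] := C1_differentiable Ao fC Ax.
by rewrite deriveE.
Qed.

Lemma Ck_comp (V : normedModType R) k (A : set V) (B : set 'cV[R]_n)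
    (u : V -> 'cV[R]_n) f : open A -> open B ->
  (forall x, A x -> B (u x)) -> Ck k B f -> Ck k A u -> Ck k A (f \o u).
Proof.
move=> Ao Bo uAB; elim: k f => [|k IH] f fC uC.
  split=> // x Ax; apply: continuous_comp; first exact: (Ck_continuous uC).
  exact: (Ck_continuous fC (uAB _ Ax)).
have fC1 : Ck 1 B f.
  by clear -fC; elim: k fC => // k IH /CkS.
have D x v : A x -> is_derive x v (f \o u)
    (\sum_j ('D_v u x) j 0 * 'D_(e_ j) f (u x)).
  move=> Ax; have [fd fE] := C1_differentiable Bo fC1 (uAB _ Ax).
  have := is_derive_comp fd (Ck_derivable v uC Ax).
  by rewrite fE.
split=> [x Ax|v].
  exact: (Ck_continuous (IH _ (CkS fC) (CkS uC))).
split=> [x Ax|]; first by case: (D x v Ax).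
have C : Ck k A (fun x => \sum_j ('D_v u x) j 0 * 'D_(e_ j) f (u x) : R^o).
  apply: Ck_sum => // j; apply: CkM => //.
    exact: ((Ck_mx _ _ Ao).1 (Ck_derive v uC) j 0).
  exact: (IH _ (Ck_derive _ fC) (CkS uC)).
by apply: Ck_ext Ao _ C => x Ax; case: (D x v Ax).
Qed.

Lemma Ck_comp_mx (V : normedModType R) p q k (A : set V) (B : set 'cV[R]_n)
    (u : V -> 'cV[R]_n) (F : 'cV[R]_n -> 'M[R]_(p, q)) : open A -> open B ->
  (forall x, A x -> B (u x)) -> Ck k B F -> Ck k A u -> Ck k A (F \o u).
Proof.
move=> Ao Bo uAB /(Ck_mx _ _ Bo) FC uC; apply/Ck_mx => // i j.
exact: (Ck_comp (f := fun x => F x i j) Ao Bo uAB).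
Qed.

Lemma derive_mx_sum p q A (F : 'cV[R]_n -> 'M[R]_(p, q)) x v :
  open A -> Ck 1 A F -> A x -> 'D_v F x = \sum_j v j 0 *: 'D_(e_ j) F x.
Proof.
move=> Ao FC Ax; apply/matrixP => i j.
have entry w : 'D_w F x i j = 'D_w (fun y => F y i j : R^o) x.
  by have /is_derive_mx/(_ i j) [_ ->] := Ck_derivable w FC Ax.
rewrite entry (derive_grad _ Ao _ Ax); last exact: ((Ck_mx _ _ Ao).1 FC).
by rewrite summxE; apply: eq_bigr => k _; rewrite !mxE entry.
Qed.

End Differentiability.

(** * Symmetry of second derivatives *)

Section Schwarz.
Context {R : realType} {V : normedModType R}.
Implicit Types (A : set V) (f : V -> R^o).

Lemma is_derive_shiftr (W : normedModType R) (f : V -> W) (c x v : V) df :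
  is_derive (x + c) v f df -> is_derive x v (fun z => f (z + c)) df.
Proof.
move=> [fd fE].
have fc : (fun h : R => h^-1 *: (f (h *: v + x + c) - f (x + c)))
        = (fun h : R => h^-1 *: (f (h *: v + (x + c)) - f (x + c))).
  by apply: funext => h; rewrite addrA.
by split; rewrite /derivable ?/derive fc.
Qed.

(** The mean value theorem is applied along [v] to [z |-> f (z + s *: w) - f z], then along [w] to
    ['D_v f]. The order of these two steps fixes the order of the mixed derivative. *)
Lemma second_difference A f x v w (s : R) :
  Ck 2 A f ->
  (forall a b, 0 <= a <= 1 -> 0 <= b <= 1 ->
     A (x + (a * s) *: v + (b * s) *: w)) ->
  exists2 ab : R * R, (0 <= ab.1 <= 1) && (0 <= ab.2 <= 1) &
    f (x + s *: v + s *: w) - f (x + s *: v) - (f (x + s *: w) - f x) =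
    s * (s * 'D_w (fun y => 'D_v f y) (x + (ab.1 * s) *: v + (ab.2 * s) *: w)).
Proof.
move=> fC Axy.
have i0 : 0 <= (0 : R) <= 1 by rewrite lexx ler01.
have i1 : 0 <= (1 : R) <= 1 by rewrite lexx ler01.
have [a a01|a a01 Ea] := @MVT_line R V (fun z => f (z + s *: w) - f z : R^o)
    (fun z => 'D_v f (z + s *: w) - 'D_v f z) x v s.
  apply: is_deriveB.
    apply: is_derive_shiftr; apply: (Ck_derivable _ fC).
    by have := Axy a 1 a01 i1; rewrite mul1r.
  apply: (Ck_derivable _ fC).
  by have := Axy a 0 a01 i0; rewrite mul0r scale0r addr0.
have [b b01|b b01 Eb] := @MVT_line R V (fun z => 'D_v f z)
    (fun z => 'D_w (fun y => 'D_v f y) z) (x + (a * s) *: v) w s.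
  apply: (Ck_derivable _ (Ck_derive v fC)).
  exact: Axy.
exists (a, b); first by rewrite a01 b01.
by rewrite Ea Eb.
Qed.

(** The second difference is symmetric in [v] and [w], so its two evaluations equate the two mixed
    derivatives at two points near [x]; continuity moves both points to [x]. *)
Lemma derive_comm A f x v w : open A -> Ck 2 A f -> A x ->
  'D_w (fun y => 'D_v f y) x = 'D_v (fun y => 'D_w f y) x.
Proof.
move=> Ao fC Ax; apply/eqP; rewrite -subr_eq0 -normr_le0; apply/ler_addgt0Pl => e e0.
rewrite addr0.
have e20 : 0 < e / 2 by rewrite divr_gt0.
have /cvgrPdist_le/(_ _ e20) H1 := Ck_continuous (Ck_derive w (Ck_derive v fC)) Ax.
have /cvgrPdist_le/(_ _ e20) H2 := Ck_continuous (Ck_derive v (Ck_derive w fC)) Ax.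
have nearx : \forall y \near x, A y /\
    (`|'D_w (fun y => 'D_v f y) x - 'D_w (fun y => 'D_v f y) y| <= e / 2 /\
     `|'D_v (fun y => 'D_w f y) x - 'D_v (fun y => 'D_w f y) y| <= e / 2).
  apply: filterI (open_nbhs_nbhs (conj Ao Ax)) _.
  exact: filterI H1 H2.
have [d /= d0 Hd] := (nbhs_ballP _ _).1 nearx.
(* With this step the whole parallelogram stays within [d / 2] of [x]; the summand 1 keeps the
   denominator positive when [v] and [w] vanish. *)
pose s := d / 2 / (`|v| + `|w| + 1).
have k0 : 0 < `|v| + `|w| + 1 by rewrite ltr_wpDl // addr_ge0.
have s0 : 0 < s by rewrite /s divr_gt0 // divr_gt0.
have inball a b : 0 <= a <= 1 -> 0 <= b <= 1 ->
    ball x d (x + (a * s) *: v + (b * s) *: w).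
  move=> /andP[a0 a1] /andP[b0 b1].
  rewrite -ball_normE /= -addrA opprD addNKr normrN.
  apply: le_lt_trans (ler_normD _ _) _; rewrite (normrZ (a * s)) (normrZ (b * s)).
  rewrite (ger0_norm (mulr_ge0 a0 (ltW s0))) (ger0_norm (mulr_ge0 b0 (ltW s0))).
  apply: (@le_lt_trans _ _ (s * (`|v| + `|w| + 1))); last first.
    by rewrite /s divfK ?gt_eqF // ltr_pdivrMr // mulr_natr mulr2n ltrDl.
  rewrite !mulrDr mulr1 -addrA lerD //.
    by rewrite ler_wpM2r // ler_piMl // ltW.
  rewrite -[leLHS]addr0 lerD //; last exact: ltW.
  by rewrite ler_wpM2r // ler_piMl // ltW.
have [|[a b] /= /andP[a01 b01] E1] := @second_difference A f x v w s fC.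
  by move=> a b a01 b01; have [] := Hd _ (inball _ _ a01 b01).
have inball' a' b' : 0 <= a' <= 1 -> 0 <= b' <= 1 ->
    ball x d (x + (a' * s) *: w + (b' * s) *: v).
  by move=> ? ?; rewrite addrAC; exact: inball.
have [|[a' b'] /= /andP[a01' b01'] E2] := @second_difference A f x w v s fC.
  by move=> a' b' ? ?; have [] := Hd _ (inball' a' b' _ _).
have EE : 'D_w (fun y => 'D_v f y) (x + (a * s) *: v + (b * s) *: w) =
    'D_v (fun y => 'D_w f y) (x + (a' * s) *: w + (b' * s) *: v).
  have sn0 : s != 0 by rewrite gt_eqF.
  apply: (mulfI sn0); apply: (mulfI sn0).
  apply: etrans (esym E1) _; apply: etrans _ E2.
  have swap (a1 a2 a3 a4 : R) : a1 - a2 - (a3 - a4) = a1 - a3 - (a2 - a4) by ring.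
  by rewrite (addrAC x (s *: w)); exact: swap.
have [_ [/= K1 _]] := Hd _ (inball _ _ a01 b01).
have [_ [_ /= K2]] := Hd _ (inball' _ _ a01' b01').
rewrite EE in K1.
have tri (c y1 y2 z : R) : `|y1 - z| <= c / 2 -> `|y2 - z| <= c / 2 ->
    `|y1 - y2| <= c.
  move=> l1 l2; apply: le_trans (ler_distD z y1 y2) _.
  by rewrite [c]splitr (distrC z) lerD.
exact: tri K1 K2.
Qed.

Lemma eq_of_zero_derive f (a v : V) :
  (forall t, 0 <= t <= 1 -> is_derive (a + t *: v) v f 0) -> f (a + v) = f a.
Proof.
move=> H; have [t|t t01] := @MVT_line R V f (fun=> 0) a v 1.
  by rewrite mulr1; exact: H.
by rewrite scale1r mulr0 => /eqP; rewrite subr_eq0 => /eqP.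
Qed.

End Schwarz.

(** * The inverse function theorem *)

(* In MathComp-Analysis matrices are normed modules and complete uniform
   spaces, but are not declared as complete normed modules. *)
HB.instance Definition _ (R : realType) (m n : nat) :=
  Uniform_isComplete.Build 'M[R]_(m, n) (@mx_complete R m n).

Lemma continuous_at_dist (R : realType) (V W : normedModType R) (f : V -> W) x :
  (forall e, 0 < e -> \forall y \near x, `|f x - f y| <= e) ->
  {for x, continuous f}.
Proof. by move=> H; apply/cvgrPdist_le. Qed.

Section InverseFunction.
Context {R : realType} {n : nat}.
Local Notation E := 'cV[R]_n.+1.

Definition jac (G : E -> E) (x : E) : 'M[R]_n.+1 :=
  \matrix_(i, j) 'D_(delta_mx j 0) (fun y => G y i 0 : R^o) x.

(** The norm is the largest absolute value of an entry, not an operator norm; each entry of the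
    product has [p] summands, hence the factor [p%:R]. *)
Lemma mx_norm_mul m p q (M : 'M[R]_(m, p)) (N : 'M[R]_(p, q)) c :
  0 <= c -> (forall i j, `|M i j| <= c) -> `|M *m N| <= p%:R * c * `|N|.
Proof.
move=> c0 H; apply: mx_norm_le => [|i j]; first by rewrite !mulr_ge0.
rewrite mxE; apply: le_trans (ler_norm_sum _ _ _) _.
have step k : true -> `|M i k * N k j| <= c * `|N|.
  by move=> _; rewrite normrM ler_pM //; exact: mx_norm_coord.
by apply: le_trans (ler_sum _ step) _; rewrite sumr_const card_ord -mulrA mulr_natl.
Qed.

Lemma derive_jac (A : set E) (G : E -> E) x v : open A -> smooth_on A G -> A x ->
  'D_v G x = jac G x *m v.
Proof.
move=> Ao GS Ax; rewrite (derive_mx_sum _ Ao (GS 1%N) Ax).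
apply/matrixP => i j; rewrite summxE !mxE (ord1 j); apply: eq_bigr => k _.
rewrite !mxE mulrC; congr (_ * _).
by have /is_derive_mx/(_ i 0) [_ ->] := smooth_derivable (delta_mx k 0) GS Ax.
Qed.

Lemma smooth_jac (A : set E) (G : E -> E) : open A -> smooth_on A G ->
  smooth_on A (jac G).
Proof.
move=> Ao GS; apply/smooth_mx => // i j.
under eq_fun do rewrite mxE.
exact/smooth_derive/((smooth_mx _ Ao).1 GS).
Qed.

Section Local.
Variables (U : set E) (p : E) (G : E -> E).
Hypotheses (Uo : open U) (Up : U p) (GS : smooth_on U G).
Hypothesis Ju : forall x, U x -> jac G x \in unitmx.

(* [G v = y] iff [v] is a fixed point of [v |-> phi v + A *m y]. *)
Let A := invmx (jac G p).
Let phi v := v - A *m G v.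
Let C := 2 * (n.+1%:R * `|A|).

Let C0 : 0 <= C. Proof. by rewrite !mulr_ge0. Qed.

Let is_derive_phi x v : U x -> is_derive x v phi ((1%:M - A *m jac G x) *m v).
Proof.
move=> Ux; rewrite mulmxBl mul1mx; apply: is_deriveB.
apply: (is_derive_eq (is_derive_mulmx (is_derive_cst A x v)
  (smooth_derivable v GS Ux))).
by rewrite mul0mx add0r (derive_jac v Uo GS Ux) mulmxA.
Qed.

(** The derivative of [phi] is [1%:M - A *m jac G x], which vanishes at [p] and is therefore small
    nearby. *)
Lemma near_contraction : exists r : R, [/\ 0 < r,
  (forall v, `|p - v| <= r -> U v) &
  forall v w, `|p - v| <= r -> `|p - w| <= r ->
    `|phi v - phi w| <= 2^-1 * `|v - w|].
Proof.
(* The factor [n.+1] lost in [mx_norm_mul] is compensated here, leaving the contraction constant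
   1/2. *)
have c0 : 0 < (2 * n.+1%:R)^-1 :> R by rewrite invr_gt0 mulr_gt0.
pose K x := 1%:M - A *m jac G x.
have Kp : K p = 0 by rewrite /K /A mulVmx ?subrr //; exact: Ju.
have KS : smooth_on U K.
  move=> k; rewrite /K.
  have -> : (fun x => 1%:M - A *m jac G x) = (fun x => 1%:M + (- A) *m jac G x).
    by apply: funext => x; rewrite mulNmx.
  apply: CkD => //; first exact: Ck_cst.
  by apply: Ck_mulmx => //; [exact: Ck_cst|exact: smooth_jac].
have nearp : \forall x \near p, U x /\ `|K x| <= (2 * n.+1%:R)^-1.
  near=> x; split; first by near: x; exact: open_nbhs_nbhs.
  near: x; have /cvgrPdist_le/(_ _ c0) := smooth_continuous KS Up.
  by apply: filterS => x; rewrite Kp sub0r normrN.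
have [d /= d0 Hd] := (nbhs_ballP _ _).1 nearp.
(* Halving the radius makes room for the non-strict condition [|p - v| <= r], needed because the
   fixed point theorem is used on a closed ball. *)
have d2d : d / 2 < d by rewrite ltr_pdivrMr // mulr_natr mulr2n ltrDl.
have Hr x : `|p - x| <= d / 2 -> U x /\ `|K x| <= (2 * n.+1%:R)^-1.
  by move=> xr; apply: Hd; rewrite -ball_normE /=; exact: le_lt_trans d2d.
exists (d / 2); split; [by rewrite divr_gt0| by move=> v /Hr []|].
move=> v w vr wr.
have Hseg t : 0 <= t <= 1 -> `|p - (w + t *: (v - w))| <= d / 2.
  move=> /andP[t0 t1].
  have -> : p - (w + t *: (v - w)) = (1 - t) *: (p - w) + t *: (p - v).
    by apply/matrixP => i j; rewrite !mxE; ring.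
  apply: le_trans (ler_normD _ _) _; rewrite !normrZ ger0_norm ?subr_ge0 //.
  rewrite (ger0_norm t0).
  have -> : d / 2 = (1 - t) * (d / 2) + t * (d / 2) by ring.
  by rewrite lerD // ler_wpM2l // subr_ge0.
(* The mean value theorem is scalar, so it is applied to each entry with its own intermediate point;
   the bound on [K] holds uniformly on the segment. *)
apply: mx_norm_le => [|i j]; first by rewrite mulr_ge0.
have [t t01|t t01] := @MVT_line R _ (fun x => phi x i j : R^o)
    (fun x => (K x *m (v - w)) i j) w (v - w) 1.
  rewrite mulr1; have [Ut _] := Hr _ (Hseg _ t01).
  by have /is_derive_mx := is_derive_phi (v - w) Ut; apply.
rewrite scale1r mul1r mulr1 (addrC w (v - w)) subrK => phiE.
have -> : (phi v - phi w) i j = phi v i j - phi w i j by rewrite !mxE.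
rewrite phiE; have [_ Kt] := Hr _ (Hseg _ t01).
apply: le_trans (mx_norm_coord (K (w + t *: (v - w)) *m (v - w)) i j) _.
apply: le_trans (mx_norm_mul (v - w) (ltW c0) _) _.
  by move=> i' j'; exact: le_trans (mx_norm_coord _ i' j') Kt.
by rewrite invfM mulrCA divff ?pnatr_eq0 // mulr1.
Unshelve. all: by end_near. Qed.

(** Since [v - w = (phi v - phi w) + A *m (G v - G w)], the contraction bound absorbs half of the
    left side; this is the 2 in [C]. *)
Lemma inverse_lipschitz v w : `|phi v - phi w| <= 2^-1 * `|v - w| ->
  `|v - w| <= C * `|G v - G w|.
Proof.
move=> H.
have -> : C * `|G v - G w| = 2 * (n.+1%:R * `|A| * `|G v - G w|).
  by rewrite /C !mulrA.
have HA := mx_norm_mul (G v - G w) (normr_ge0 A) (@mx_norm_coord _ _ _ A).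
have E : v - w = (phi v - phi w) + A *m (G v - G w).
  rewrite mulmxBr /phi; move: (A *m G v) (A *m G w) => a b.
  by apply/matrixP => i j; rewrite !mxE; ring.
have := ler_normD (phi v - phi w) (A *m (G v - G w)); rewrite -E => H1.
move: (`|_ - _|) HA H H1 => ? HA H H1; lra.
Qed.

(** The inverse is not a fixed function: any [u] selecting preimages in [V] is shown to be smooth.
    This is the form in which part (a) speaks of solving the equations for [u]. *)
Lemma inverse_function : exists W V : set E,
  [/\ open W, W (G p), open V, V p & V `<=` U] /\
  (forall y, W y -> exists! v, V v /\ G v = y) /\
  (forall u : E -> E, (forall y, W y -> V (u y) /\ G (u y) = y) ->
    smooth_on W u /\
    forall y w, W y -> 'D_w u y = invmx (jac G (u y)) *m w).
Proof.
have [r [r0 rU contr]] := near_contraction.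
(* Measured through [A], this is exactly what makes [T] send the closed ball into the open one: the
   contraction gives at most [r / 2], the shift by [y] strictly less than [r / 2]. *)
pose W := [set y : E | `|A *m (y - G p)| < r / 2].
pose V := [set v : E | `|p - v| < r].
have pr : `|p - p| <= r by rewrite subrr normr0 ltW.
have r2r : r / 2 < r by rewrite ltr_pdivrMr // mulr_natr mulr2n ltrDl.
have Wo : open W.
  have fC : continuous (fun y : E => `|A *m (y - G p)|).
    move=> y; apply: (continuous_comp (f := fun y : E => A *m (y - G p))
      (g := fun z : E => `|z|)); last exact: norm_continuous.
    have cA : @Ck R E E 0 setT (fun y : E => A *m ((y : E) - G p)).
      apply: Ck_mulmx; [exact: openT|exact: Ck_cst|].
      apply: CkD; [exact: openT| |exact: Ck_cst].
      by split=> // ? _; exact: cvg_id.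
    exact: (Ck_continuous cA).
  apply: (@open_comp _ _ (fun y : E => `|A *m (y - G p)|) [set x | x < r / 2]).
    by move=> y _; exact: fC.
  exact: open_lt.
have Vo : open V.
  have -> : V = ball p r by rewrite -ball_normE.
  exact: ball_open.
have VU : V `<=` U by move=> v vr; apply: rU; exact: ltW.
have Au : A \in unitmx by rewrite unitmx_inv; exact: Ju.
exists W, V; split; first split=> //.
- by rewrite /W /= subrr mulmx0 normr0 divr_gt0.
- by rewrite /V /= subrr normr0.
split.
  move=> y Wy.
  pose T v := phi v + A *m y.
  pose B := [set v : E | `|p - v| <= r].
  have TV v : B v -> V (T v).
    move=> Bv; rewrite /V /=.
    have -> : p - T v = (phi p - phi v) - A *m (y - G p).
      rewrite /T /phi mulmxBr; move: (A *m G v) (A *m G p) (A *m y) => a b c.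
      by apply/matrixP => i j; rewrite !mxE; ring.
    apply: le_lt_trans (ler_normB _ _) _.
    have H1 : `|phi p - phi v| <= 2^-1 * r.
      by apply: le_trans (contr _ _ pr Bv) _; rewrite ler_wpM2l // invr_ge0.
    by move: Wy; rewrite /W /= => Wy; lra.
  have TB : set_fun B B T by move=> v /TV /ltW.
  have ctr : is_contraction (mkfun TB).
    exists (2^-1)%:nng; split; first by rewrite /= invf_lt1 // ltr1n.
    move=> [v w] [/= Bv Bw].
    have -> : T v - T w = phi v - phi w by rewrite /T opprD addrACA subrr addr0.
    exact: contr.
  have clB : closed B.
    have -> : B = closed_ball p r by rewrite closed_ballE.
    exact: closed_ball_closed.
  have [|v Bv /= vT] := banach_fixed_point ctr clB; first by exists p.
  have GT w : w = T w <-> G w = y.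
    rewrite /T /phi; split=> [E|->]; last by rewrite subrK.
    have : A *m (y - G w) = 0.
      rewrite mulmxBr; apply: (addrI w); rewrite addr0 [RHS]E.
      by rewrite addrCA addrC.
    by move=> /(congr1 (mulmx (invmx A))); rewrite mulKmx // mulmx0 => /eqP;
      rewrite subr_eq0 => /eqP.
  exists v; split; first by split; [rewrite vT; exact: TV|apply/GT].
  move=> w [Vw Gw]; have Bw : B w by exact: ltW.
  exact: (contraction_fixpoint_unique ctr Bv Bw vT ((GT w).2 Gw)).
move=> u uP.
have uL y z : W y -> W z -> `|u y - u z| <= C * `|y - z|.
  move=> /uP [Vy Ey] /uP [Vz Ez]; rewrite -[in leRHS]Ey -[in leRHS]Ez.
  by apply: inverse_lipschitz; apply: contr; exact: ltW.
have nearW0 y w : W y -> \forall h \near (0 : R), W (h *: w + y).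
  move=> Wy; have : {for (0 : R), continuous (fun h : R => h *: w + y)}.
    apply: cvgD; last exact: cvg_cst.
    exact: scalel_continuous.
  rewrite /prop_for /continuous_at scale0r add0r; apply.
  exact: open_nbhs_nbhs.
have uc y : W y -> {for y, continuous u}.
  move=> Wy; apply: continuous_at_dist => e e0.
  have C10 : 0 < C + 1 by rewrite ltr_wpDl.
  have nW : nbhs y W by exact: open_nbhs_nbhs.
  have nB : nbhs y (ball y ((C + 1)^-1 * e)).
    by apply: nbhsx_ballx; rewrite mulr_gt0 // invr_gt0.
  apply: filterS2 nW nB => z Wz; rewrite -ball_normE /= => yz.
  apply: le_trans (uL _ _ Wy Wz) _.
  apply: (@le_trans _ _ ((C + 1) * `|y - z|)); first by rewrite ler_wpM2r // lerDl.
  by rewrite -ler_pdivlMl // ltW.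
(* With [k] the increment of [u], differentiability of [G] gives [J *m k = h *: w + o(|k|)], and the
   Lipschitz bound makes [|k|] at most a constant times [|h|]; dividing by [h] gives the limit. *)
have ud y w : W y -> is_derive y w u (invmx (jac G (u y)) *m w).
  move=> Wy; have [Vy Gy] := uP _ Wy; have Uy := VU _ Vy.
  set J := jac G (u y); have Junit : J \in unitmx by exact: Ju.
  pose q h := h^-1 *: (u (h *: w + y) - u y).
  suff lim : q h @[h --> (0 : R)^'] --> invmx J *m w.
    by split; [apply/cvg_ex; exists (invmx J *m w)|exact/cvg_lim].
  apply/cvgrPdist_le => e e0.
  (* [K] collects all factors that the error [e / K] acquires below; adding 1 makes it positive. *)
  pose K := n.+1%:R * `|invmx J| * (C * `|w|) + 1.
  have K0 : 0 < K by rewrite ltr_wpDl // !mulr_ge0.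
  have eK : 0 < e / K by rewrite divr_gt0.
  have diffG i : \forall k \near (0 : E),
      `|G (k + u y) i 0 - G (u y) i 0 - (J *m k) i 0| <= e / K * `|k|.
    have GiS : smooth_on U (fun x => G x i 0 : R^o) by apply: ((smooth_mx _ Uo).1 GS).
    have Gd := smooth_differentiable Uo GiS Uy.
    have Gi1 := diff_locallyx Gd.
    near=> k.
    have -> : (J *m k) i 0 = 'd (fun x => G x i 0 : R^o) (u y) k.
      rewrite -deriveE // -(derive_jac k Uo GS Uy).
      by have /is_derive_mx/(_ i 0) [_ ->] := smooth_derivable k GS Uy.
    have cancel (a b c : R) : a + b + c - a - b = c by ring.
    rewrite Gi1 cancel.
    near: k; exact: littleoP.
  have [d /= d0 Hd] := (nbhs_ballP _ _).1 (filter_forall _ diffG).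
  near=> h.
  have hn0 : h != 0 by near: h; exact: nbhs_dnbhs_neq.
  have Wh : W (h *: w + y) by near: h; apply: nbhs_dnbhs; exact: nearW0.
  have [Vh Gh] := uP _ Wh.
  pose k := u (h *: w + y) - u y.
  have kC : `|k| <= C * (`|h| * `|w|).
    by apply: le_trans (uL _ _ Wh Wy) _; rewrite addrK normrZ.
  have kd : `|k| < d.
    apply: le_lt_trans kC _.
    near: h; apply: nbhs_dnbhs; apply/nbhs_ballP.
    have D0 : 0 < (C + 1) * (`|w| + 1) by rewrite mulr_gt0 // ltr_wpDl.
    exists (d / ((C + 1) * (`|w| + 1))); first by rewrite /= divr_gt0.
    move=> h; rewrite -ball_normE /= sub0r normrN ltr_pdivlMr // => hd.
    apply: le_lt_trans hd; rewrite mulrCA ler_wpM2l //.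
    by rewrite ler_pM // lerDl.
  have JqE : `|J *m q h - w| <= e / K * (C * `|w|).
    have qk : J *m q h - w = h^-1 *: (J *m k - h *: w).
      by rewrite scalerBr scalemxAr scalerK.
    have wG : h *: w = G (k + u y) - G (u y) by rewrite subrK Gh Gy addrK.
    have kle : `|J *m k - h *: w| <= e / K * `|k|.
      apply: mx_norm_le => [|i j]; first by rewrite mulr_ge0 // ltW.
      have Bk : ball 0 d k by rewrite -ball_normE /= sub0r normrN.
      have mxB (a b : E) : (a - b) i 0 = a i 0 - b i 0 by rewrite !mxE.
      rewrite (ord1 j) wG !mxB distrC.
      exact: Hd _ Bk i.
    rewrite qk normrZ normfV ler_pdivrMl ?normr_gt0 //.
    apply: le_trans kle _; rewrite mulrCA ler_wpM2l ?(ltW eK) //.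
    by apply: le_trans kC _; rewrite mulrCA.
  have -> : invmx J *m w - q h = invmx J *m (w - J *m q h).
    by rewrite mulmxBr mulKmx.
  apply: le_trans (mx_norm_mul (w - J *m q h) (normr_ge0 _) (@mx_norm_coord _ _ _ _)) _.
  rewrite distrC; apply: le_trans (ler_wpM2l _ JqE) _; first by rewrite mulr_ge0.
  rewrite mulrCA -[leRHS](divfK (lt0r_neq0 K0)) ler_wpM2l ?(ltW eK) //.
  by rewrite /K lerDl.
split; last by move=> y w /ud - /(_ w) [].
(* Bootstrap: if [u] is C^k, then its derivative [invmx (jac G (u y)) *m w] is C^k as well, so [u]
   is C^(k+1). *)
elim=> [|k IH]; first by split.
split=> // w; split=> [y Wy|]; first by case: (ud y w Wy).
have FC : Ck k U (fun x => invmx (jac G x)).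
  by apply: Ck_invmx => //; exact: smooth_jac.
have C1 := Ck_comp_mx Wo Uo (fun y Wy => VU _ (proj1 (uP y Wy))) FC IH.
have C2 := Ck_mulmx Wo C1 (Ck_cst k W w).
by apply: Ck_ext Wo _ C2 => y Wy; case: (ud y w Wy).
Unshelve. all: by end_near. Qed.

End Local.
End InverseFunction.

(** * The Poincare lemma on a ball *)

Section Poincare.
Context {R : realType} {n : nat}.
Local Notation E := 'cV[R]_n.
Variables (p : E) (r : R) (theta : E -> 'rV[R]_n) (K : R).
Hypothesis r0 : 0 < r.
Let B := ball p r.
Hypothesis thetaS : smooth_on B theta.
Hypothesis theta_closed :
  forall x v w, B x -> 'D_v theta x *m w = 'D_w theta x *m v.
Hypothesis theta_bnd : forall x, B x -> `|theta x| <= K.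
Hypothesis dtheta_bnd :
  forall x j, B x -> `|'D_(delta_mx j 0) theta x| <= K.

Let Bo : open B. Proof. exact: ball_open. Qed.

Let K0 : 0 <= K.
Proof. by apply: le_trans (theta_bnd (ballxx p r0)); exact: normr_ge0. Qed.

Lemma ball_segment v w t : B v -> B w -> 0 <= t <= 1 -> B (v + t *: (w - v)).
Proof.
rewrite /B -ball_normE /= => Bv Bw /andP[t0 t1].
have -> : p - (v + t *: (w - v)) = (1 - t) *: (p - v) + t *: (p - w).
  by apply/matrixP => i j; rewrite !mxE; ring.
apply: le_lt_trans (ler_normD _ _) _; rewrite !normrZ ger0_norm ?subr_ge0 //.
rewrite (ger0_norm t0).
have -> : r = (1 - t) * r + t * r by ring.
have [->|tn0] := eqVneq t 0.
  by rewrite !mul0r !addr0 subr0 !mul1r.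
rewrite ler_ltD ?ler_wpM2l ?subr_ge0 ?(ltW Bv) //.
by rewrite ltr_pM2l // lt_neqAle eq_sym tn0.
Qed.

Definition radial_integrand (v : E) (t : R) : R :=
  (theta (p + t *: (v - p)) *m (v - p)) 0 0.

(** The homotopy operator of the Poincare lemma: the integral of [theta] along the segment from [p]
    to [v]. *)
Definition radial_primitive (v : E) : R^o :=
  (\int[lebesgue_measure]_(t in `[0%R, 1%R]) radial_integrand v t)%R.

Let Bseg v t : B v -> 0 <= t <= 1 -> B (p + t *: (v - p)).
Proof. by move=> Bv; apply: ball_segment => //; exact: ballxx. Qed.

(** The derivative in [s] of the integrand at the endpoint [s *: w + v]. The first term comes from
    moving the point where [theta] is evaluated, by [t *: w] per unit of [s], the second from moving
    the vector it is applied to. *)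
Let d_integrand (w v : E) (s t : R) : R :=
  (t *: 'D_w theta (p + t *: (s *: w + v - p)) *m (s *: w + v - p) +
   theta (p + t *: (s *: w + v - p)) *m w) 0 0.

Let is_derive_integrand v w s t : B (s *: w + v) -> 0 <= t <= 1 ->
  is_derive (s : R^o) 1 (fun s : R^o => radial_integrand (s *: w + v) t : R^o)
    (d_integrand w v s t).
Proof.
move=> Bs t01; have Bx := Bseg Bs t01.
have pE s' : p + t *: (s' *: w + v - p) = p + t *: (v - p) + s' *: (t *: w).
  by apply/matrixP => i j; rewrite !mxE; ring.
have vE s' : s' *: w + v - p = (v - p) + s' *: w by rewrite -addrA addrC.
rewrite /radial_integrand /d_integrand.
under eq_fun do rewrite pE vE.
rewrite pE in Bx; rewrite pE vE.
have D1 := is_derive_line (is_derive_scale t (smooth_derivable w thetaS Bx)).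
have D2 := is_derive_line (is_derive_id (v - p + s *: w) w).
by have /is_derive_mx := is_derive_mulmx D1 D2; apply.
Qed.

Let ray_continuous (v : E) (t : R) :
  {for t, continuous (fun t : R => p + t *: (v - p))}.
Proof.
apply: cvgD; first exact: cvg_cst.
exact: scalel_continuous.
Qed.

Let integrable_continuous (f : R -> R) :
  (forall t, 0 <= t <= 1 -> {for t, continuous f}) ->
  lebesgue_measure.-integrable `[0%R, 1%R] (EFin \o f).
Proof.
move=> fc; apply: continuous_compact_integrable; first exact: segment_compact.
apply: continuous_in_subspaceT => t; rewrite inE /= in_itv /= => t01.
exact: fc.
Qed.

Let integrand_continuous v t : B v -> 0 <= t <= 1 ->
  {for t, continuous (radial_integrand v)}.
Proof.
move=> Bv t01.
have Bt := Bseg Bv t01.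
have C : Ck 0 B (fun x => (theta x *m (v - p)) 0 0 : R^o).
  exact: ((Ck_mx _ _ Bo).1 (Ck_mulmx Bo (thetaS 0%N) (Ck_cst _ _ _)) 0 0).
apply: (continuous_comp (f := fun t : R => p + t *: (v - p))
  (g := fun x => (theta x *m (v - p)) 0 0)).
  exact: ray_continuous.
exact: (Ck_continuous C).
Qed.

Let d_integrand_continuous w v t : B v -> 0 <= t <= 1 ->
  {for t, continuous (d_integrand w v 0)}.
Proof.
move=> Bv t01.
have Bt := Bseg Bv t01.
have C1 : Ck 0 B (fun x => ('D_w theta x *m (v - p)) 0 0 : R^o).
  exact: ((Ck_mx _ _ Bo).1
    (Ck_mulmx Bo (smooth_derive w thetaS 0%N) (Ck_cst _ _ _)) 0 0).
have C2 : Ck 0 B (fun x => (theta x *m w) 0 0 : R^o).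
  exact: ((Ck_mx _ _ Bo).1 (Ck_mulmx Bo (thetaS 0%N) (Ck_cst _ _ _)) 0 0).
have -> : d_integrand w v 0 = fun t =>
    t * ('D_w theta (p + t *: (v - p)) *m (v - p)) 0 0 +
    (theta (p + t *: (v - p)) *m w) 0 0.
  apply: funext => s; rewrite /d_integrand scale0r add0r -scalemxAl.
  by rewrite [LHS]mxE [X in X + _]mxE.
apply: cvgD; first apply: cvgM; first exact: cvg_id.
  apply: (continuous_comp (f := fun t : R => p + t *: (v - p))
    (g := fun x => ('D_w theta x *m (v - p)) 0 0)).
    exact: ray_continuous.
  exact: (Ck_continuous C1).
apply: (continuous_comp (f := fun t : R => p + t *: (v - p))
  (g := fun x => (theta x *m w) 0 0)).
  exact: ray_continuous.
exact: (Ck_continuous C2).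
Qed.

(* This is where closedness enters: the derivative of the integrand in the
   direction [w] is the total [t]-derivative of [t * theta(p + t (v - p)) w]. *)
Let is_derive_end w v t : B v -> 0 <= t <= 1 ->
  is_derive (t : R^o) 1
    (fun t : R^o => t * (theta (p + t *: (v - p)) *m w) 0 0 : R^o)
    (d_integrand w v 0 t).
Proof.
move=> Bv t01; have Bt := Bseg Bv t01.
have D1 := is_derive_line (smooth_derivable (v - p) thetaS Bt).
have D2 := is_derive_mulmx D1 (is_derive_cst w (t : R^o) 1).
have D3 := is_derive_mulr (is_derive_id (t : R^o) (1 : R^o))
  ((is_derive_mx _ _ _ _).1 D2 0 0).
apply: is_derive_eq D3 _.
rewrite mul1r mulmx0 addr0 /d_integrand scale0r add0r theta_closed //.
by rewrite -scalemxAl [RHS]mxE [X in _ = X + _]mxE addrC.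
Qed.

(** The integrand is the derivative of [t * theta(p + t (v - p)) w], which is 0 at [t = 0] and
    [theta(v) w] at [t = 1]. *)
Let integral_d_integrand w v : B v ->
  (\int[lebesgue_measure]_(t in `[0%R, 1%R]) d_integrand w v 0 t)%R
  = (theta v *m w) 0 0.
Proof.
move=> Bv.
pose F t : R := t * (theta (p + t *: (v - p)) *m w) 0 0.
have Fc t : 0 <= t <= 1 -> {for t, continuous F}.
  move=> t01; apply/differentiable_continuous/derivable1_diffP.
  by case: (is_derive_end w Bv t01).
rewrite /Rintegral (@continuous_FTC2 _ _ F) //.
- by rewrite /F mul1r mul0r scale1r (addrC p) subrK sube0.
- apply: continuous_in_subspaceT => t; rewrite inE /= in_itv /= => t01.
  exact: d_integrand_continuous.
- split.
  + move=> t; rewrite in_itv /= => /andP[t0 t1].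
    have t01 : 0 <= t <= 1 by rewrite !ltW.
    by case: (is_derive_end w Bv t01).
  + by apply: cvg_at_right_filter; apply: Fc; rewrite lexx ler01.
  + by apply: cvg_at_left_filter; apply: Fc; rewrite lexx ler01.
- move=> t; rewrite in_itv /= => /andP[t0 t1].
  have t01 : 0 <= t <= 1 by rewrite !ltW.
  by rewrite derive1E; case: (is_derive_end w Bv t01).
Qed.

Let dtheta_norm x w : B x -> `|'D_w theta x| <= n%:R * (`|w| * K).
Proof.
move=> Bx; rewrite (derive_mx_sum w Bo (thetaS 1%N) Bx).
apply: le_trans (ler_norm_sum _ _ _) _.
have step j : true -> `|w j 0 *: 'D_(delta_mx j 0) theta x| <= `|w| * K.
  move=> _; rewrite normrZ ler_pM //; [exact: mx_norm_coord|exact: dtheta_bnd].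
by apply: le_trans (ler_sum _ step) _; rewrite sumr_const card_ord mulr_natl.
Qed.

Lemma is_derive_radial_primitive v w : B v ->
  is_derive v w radial_primitive ((theta v *m w) 0 0).
Proof.
move=> Bv.
have near0 : \forall s \near (0 : R), B (s *: w + v).
  have : {for (0 : R), continuous (fun h : R => h *: w + v)}.
    apply: cvgD; last exact: cvg_cst.
    exact: scalel_continuous.
  rewrite /prop_for /continuous_at scale0r add0r; apply.
  exact: open_nbhs_nbhs.
have [d /= d0 Hd] := (nbhs_ballP _ _).1 near0.
have Bs s : `]-d, d[%classic s -> B (s *: w + v).
  rewrite /= in_itv /= => sd; apply: Hd.
  by rewrite -ball_normE /= sub0r normrN ltr_norml.
(* A constant dominating function for differentiation under the integral sign; its two summands
   bound the two terms of [d_integrand]. *)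
pose G := n%:R * (n%:R * (`|w| * K)) * (r : R) + n%:R * K * `|w|.
have I0 : `]-d, d[%classic (0 : R) by rewrite /= in_itv /= oppr_lt0 d0.
have mB : measurable (`[0%R, 1%R]%classic : set (measurableTypeR R)) by [].
have intf s : `]-d, d[%classic s ->
    lebesgue_measure.-integrable `[0%R, 1%R]
      (EFin \o (fun t => radial_integrand (s *: w + v) t)).
  move=> /Bs Bsw; apply: integrable_continuous => t t01.
  exact: integrand_continuous.
have derf s t : `]-d, d[%classic s -> `[0%R, 1%R]%classic t ->
    is_derive (s : R^o) 1 (fun s : R^o => radial_integrand (s *: w + v) t : R^o)
      (d_integrand w v s t).
  by move=> /Bs Bsw; rewrite /= in_itv /= => t01; exact: is_derive_integrand.
have G0 : 0 <= G by rewrite addr_ge0 // !mulr_ge0 // ltW.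
have intG : lebesgue_measure.-integrable `[0%R, 1%R] (EFin \o (fun _ : R => G)).
  by apply: integrable_continuous => t _; exact: cvg_cst.
have G_ub s t : `]-d, d[%classic s -> `[0%R, 1%R]%classic t ->
    `|partial1of2 (fun s t => radial_integrand (s *: w + v) t) s t| <= G.
  move=> Is It; rewrite partial1of2E.
  have [_ ->] := derf s t Is It.
  move: It; rewrite /= in_itv /= => t01.
  have Bsw := Bs _ Is; have Bt := Bseg Bsw t01.
  have nr : `|s *: w + v - p| <= r.
    by rewrite distrC ltW //; move: Bsw; rewrite /B -ball_normE.
  rewrite /d_integrand; apply: le_trans (mx_norm_coord _ 0 0) _.
  apply: le_trans (ler_normD _ _) _; apply: lerD.
    rewrite -scalemxAl normrZ.
    have [t0 t1] := andP t01.
    rewrite (ger0_norm t0) -[leRHS]mul1r ler_pM //.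
    apply: le_trans (mx_norm_mul _ (normr_ge0 _) (@mx_norm_coord _ _ _ _)) _.
    by rewrite ler_pM // ler_pM // dtheta_norm.
  apply: le_trans (mx_norm_mul _ (normr_ge0 _) (@mx_norm_coord _ _ _ _)) _.
  by rewrite ler_wpM2r // ler_wpM2l // theta_bnd.
have derf' s t : `]-d, d[%classic s -> `[0%R, 1%R]%classic t ->
    derivable (fun s : R => radial_integrand (s *: w + v) t) s 1.
  by move=> Is It; case: (derf s t Is It).
have dF := @derivable_under_integral R _ (measurableTypeR R)
  lebesgue_measure (fun s t => radial_integrand (s *: w + v) t) _ mB _ _ _ I0
  intf derf' _ (fun=> G0) intG G_ub.
have DF := @differentiation_under_integral R _ (measurableTypeR R)
  lebesgue_measure (fun s t => radial_integrand (s *: w + v) t) _ mB _ _ _ I0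
  intf derf' _ (fun=> G0) intG G_ub.
split; first by apply/derivable1P.
have -> : 'D_w radial_primitive v =
    derive1 (fun s : R => radial_primitive (s *: w + v)) 0.
  have fE : (fun h : R => h^-1 *: (radial_primitive (h *: w + v) - radial_primitive v))
    = (fun h : R => h^-1 *: (radial_primitive ((h + 0) *: w + v) -
                             radial_primitive (0 *: w + v))).
    by apply: funext => h; rewrite addr0 scale0r add0r.
  by rewrite /derive1 /derive fE.
rewrite -(integral_d_integrand w Bv) /radial_primitive DF.
apply: eq_Rintegral => t; rewrite inE => It; rewrite partial1of2E.
by case: (derf 0 t I0 It).
Qed.

(** All directional derivatives are components of the smooth [theta]. Continuity does not follow
    from directional derivability and is obtained from the mean value theorem and the bound [K]. *)
Lemma radial_primitive_smooth : smooth_on B radial_primitive.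
Proof.
apply: smooth_of_derive.
- move=> v Bv; apply: continuous_at_dist => e e0.
  have NK0 : 0 < n%:R * K + 1 by rewrite ltr_wpDl // mulr_ge0.
  have nB : nbhs v B by exact: open_nbhs_nbhs.
  have nb : nbhs v (ball v ((n%:R * K + 1)^-1 * e)).
    by apply: nbhsx_ballx; rewrite mulr_gt0 // invr_gt0.
  apply: filterS2 nB nb => z Bz; rewrite -ball_normE /= => vz.
  have [t t01|t t01] := @MVT_line R _ radial_primitive
      (fun x => (theta x *m (v - z)) 0 0) z (v - z) 1.
    by apply: is_derive_radial_primitive; rewrite mulr1; exact: ball_segment.
  rewrite scale1r (addrC z (v - z)) subrK mul1r mulr1 => ->.
  apply: le_trans (mx_norm_coord _ 0 0) _.
  apply: le_trans (mx_norm_mul _ (normr_ge0 _) (@mx_norm_coord _ _ _ _)) _.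
  apply: (@le_trans _ _ ((n%:R * K + 1) * `|v - z|)).
    rewrite ler_wpM2r // -[leLHS]addr0 lerD // ler_wpM2l //.
    by apply: theta_bnd; exact: ball_segment.
  by rewrite -ler_pdivlMl // ltW.
- by move=> v w Bv; case: (is_derive_radial_primitive w Bv).
move=> w.
have C : smooth_on B (fun v => (theta v *m w) 0 0 : R^o).
  move=> k; exact: ((Ck_mx _ _ Bo).1 (Ck_mulmx Bo (thetaS k) (Ck_cst _ _ _)) 0 0).
apply: smooth_ext Bo _ C => v Bv.
by case: (is_derive_radial_primitive w Bv).
Qed.

Lemma radial_primitive0 : radial_primitive p = 0.
Proof.
rewrite /radial_primitive /radial_integrand subrr.
under eq_Rintegral do rewrite mulmx0 mxE.
by rewrite Rintegral_cst // mul0r.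
Qed.

End Poincare.

(** * Cyclic vectors and companion matrices *)

Section CyclicVectors.
Context {R : realType} {n : nat}.
Local Notation E := 'cV[R]_n.+1.
Local Notation Op := 'M[R]_n.+1.
Implicit Types (A B K F : Op) (v w : E).

(* The hypothesis makes [A] self-adjoint for the skew form [K], so the values
   of the form on [A ^+ i v], [A ^+ j v] depend only on [i + j]: they are both
   symmetric and skew-symmetric in [(i, j)]. *)
Lemma skew_cyclic_eq0 A K v : cyclic_vector A v -> K^T = - K ->
  (forall a : E, a^T *m (A^T *m K) *m a = 0) -> K = 0.
Proof.
move=> Av Ks alt.
(* Polarization on basis vectors: a matrix whose quadratic form vanishes is skew. *)
have quad (S : Op) : (forall a : E, a^T *m S *m a = 0) -> S^T = - S.
  move=> HS; apply/matrixP => i j; rewrite [LHS]mxE [RHS]mxE.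
  have ent k l : (delta_mx k 0 : E)^T *m S *m (delta_mx l 0 : E) = (S k l)%:M.
    by rewrite trmx_delta -rowE -colE; apply/matrixP => x y; rewrite !mxE !ord1.
  have := HS (delta_mx i 0 + delta_mx j 0).
  rewrite [(_ + _)^T]raddfD /= !(mulmxDl, mulmxDr) !HS add0r addr0 !ent.
  move=> /matrixP /(_ 0 0); rewrite !mxE eqxx !mulr1n => /eqP.
  by rewrite addr_eq0 => /eqP.
have AK : A^T *m K = K *m A.
  have := quad _ alt; rewrite trmx_mul trmxK Ks mulNmx => /oppr_inj ->.
  by [].
pose X := \matrix_(i < n.+1) (A ^+ i *m v)^T.
have Xu : X \in unitmx by rewrite -row_free_unit.
have AtK k : (A ^+ k)^T *m K = K *m A ^+ k.
  elim: k => [|k IH]; first by rewrite !expr0 trmx1 mul1mx mulmx1.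
  by rewrite exprS -mulmxE trmx_mul -mulmxA AK mulmxA IH -mulmxA mulmxE -exprSr exprS.
have s0 m : v^T *m K *m (A ^+ m *m v) = 0.
  have H : (v^T *m K *m (A ^+ m *m v))^T = - (v^T *m K *m (A ^+ m *m v)).
    rewrite !trmx_mul trmxK Ks mulNmx mulmxN; congr (- _).
    by rewrite -!mulmxA; congr (_ *m _); rewrite [LHS]mulmxA AtK -mulmxA.
  apply/matrixP => i j; rewrite !ord1 [RHS]mxE.
  move/matrixP: H => /(_ 0 0); rewrite [LHS]mxE [RHS]mxE.
  by move: (_ 0 0) => x xE; lra.
have XKX : X *m K *m X^T = 0.
  apply/matrixP => i j.
  have -> : (X *m K *m X^T) i j = ((A ^+ i *m v)^T *m K *m (A ^+ j *m v)) 0 0.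
    have -> : (X *m K *m X^T) i j = (row i X *m K *m col j X^T) 0 0.
      rewrite -row_mul [LHS]mxE [RHS]mxE; apply: eq_bigr => k _.
      by rewrite [row _ _ _ _]mxE [col _ _ _ _]mxE.
    by rewrite -tr_row !rowK trmxK.
  rewrite [RHS]mxE trmx_mul -(mulmxA v^T) AtK (mulmxA v^T K).
  by rewrite -(mulmxA (v^T *m K)) (mulmxA (A ^+ i)) mulmxE -exprD s0 mxE.
have : invmx X *m (X *m K *m X^T) *m invmx X^T = 0 by rewrite XKX mulmx0 mul0mx.
by rewrite !mulmxA mulVmx // mul1mx mulmxK // unitmx_tr.
Qed.

(** An operator commuting with [A] is known on the basis [A ^+ i *m w] once it is known on [w],
    whence uniqueness. For existence, the polynomial in [A] whose coefficients are the coordinates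
    of [v] in that basis will do. *)
Lemma commutant_cyclic A w v : cyclic_vector A w ->
  exists! B, Mhat_spec A w v B.
Proof.
move=> Aw; set X := \matrix_(i < n.+1) (A ^+ i *m w)^T.
have Xu : X \in unitmx by rewrite -row_free_unit.
pose c := v^T *m invmx X.
pose B : Op := \sum_i c 0 i *: A ^+ i.
have commA (S : Op) k : S *m A = A *m S -> S *m A ^+ k = A ^+ k *m S.
  move=> SA; elim: k => [|k IH]; first by rewrite expr0 mulmx1 mul1mx.
  by rewrite exprS -mulmxE mulmxA SA -mulmxA IH mulmxA.
have BP : Mhat_spec A w v B.
  split.
    rewrite mulmx_suml mulmx_sumr; apply: eq_bigr => i _.
    by rewrite -scalemxAl -scalemxAr mulmxE -exprSr exprS.
  apply: trmx_inj; rewrite mulmx_suml linear_sum /=.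
  have <- : c *m X = v^T by rewrite mulmxKV.
  rewrite mulmx_sum_row; apply: eq_bigr => i _.
  by rewrite rowK -scalemxAl linearZ.
have XS (S : Op) : Mhat_spec A w v S ->
    X *m S^T = \matrix_(i < n.+1) (A ^+ i *m v)^T.
  move=> [SA Sw]; apply/row_matrixP => i.
  by rewrite row_mul !rowK -trmx_mul mulmxA commA // -mulmxA Sw.
exists B; split=> // B' B'P; apply: trmx_inj.
by rewrite -[LHS](mulKmx Xu) -[RHS](mulKmx Xu) !XS.
Qed.

Definition companion A : Op :=
  \matrix_(i, j) (if (i < n)%N then (j == i.+1 :> nat)%:R
                  else - (char_poly A)`_j).

(** Multiplication by [A] shifts each row to the next; the image of the last row is expanded in the
    rows by Cayley-Hamilton. *)
Lemma companionP A F :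
  (forall i : 'I_n.+1, row i F = row 0 F *m A ^+ i) ->
  F *m A = companion A *m F.
Proof.
move=> HF; apply/row_matrixP => i; rewrite !row_mul.
have [ilt|ige] := ltnP i n.
  have -> : row i (companion A) = delta_mx 0 (Ordinal (ilt : (i.+1 < n.+1)%N)).
    by apply/rowP => j; rewrite !mxE ilt eqxx.
  by rewrite -rowE (HF (Ordinal _)) (HF i) /= exprSr -mulmxE mulmxA.
have iE : i = n :> nat by apply/eqP; rewrite eqn_leq ige -ltnS ltn_ord.
have CH : A ^+ n.+1 = - \sum_(j < n.+1) (char_poly A)`_j *: A ^+ j.
  have := Cayley_Hamilton A; rewrite -[in X in X -> _](coefK (char_poly A)).
  rewrite size_char_poly poly_def raddf_sum /= big_ord_recr /=.
  have /monicP := char_poly_monic A; rewrite lead_coefE size_char_poly /= => ->.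
  rewrite scale1r rmorphXn /= horner_mx_X => /eqP; rewrite addrC addr_eq0 => /eqP ->.
  congr (- _); apply: eq_bigr => j _.
  by rewrite linearZ /= rmorphXn /= horner_mx_X.
rewrite (HF i) iE -mulmxA mulmxE -exprSr CH mulmxN mulmx_sumr.
rewrite mulmx_sum_row -sumrN; apply: eq_bigr => j _.
rewrite !mxE iE ltnn scaleNr (HF j) -scalemxAr.
by [].
Qed.

(* The [w j] are the vectors dual to the rows of [F], in reversed order; the
   columns of the companion matrix give
   [A w_j = w_(j+1) + sigma_(j+1) w_0]. *)
Lemma companion_chain A F (w : nat -> E) : F \in unitmx ->
  F *m A = companion A *m F ->
  (forall j : nat, (j <= n)%N -> F *m w j = delta_mx (inord (n - j)) 0) ->
  forall j : nat, (j <= n)%N -> w j = Acoef A j *m w 0%N.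
Proof.
move=> Fu FA Fw; elim=> [|j IH] jn; first by rewrite mul1mx.
rewrite /= mulmxBl -mulmxA -IH ?(ltnW jn) // mul_scalar_mx.
apply: (can_inj (mulKmx Fu)).
rewrite mulmxBr mulmxA FA -mulmxA -scalemxAr !Fw ?(ltnW jn) // -colE.
apply/matrixP => i k; rewrite !mxE !ord1 eqxx !andbT subn0.
have nj : (n - j.+1 < n.+1)%N by rewrite ltnS leq_subr.
have nj' : (n - j < n.+1)%N by rewrite ltnS leq_subr.
rewrite -!val_eqE /= !inordK //.
have -> : (n - j = (n - j.+1).+1)%N by rewrite subnSK.
have [ilt|ige] := ltnP i n.
  by rewrite (ltn_eqF ilt) mulr0 subr0 eqSS eq_sym.
(* In the last row the companion entry [- (char_poly A)_(n-j)] is [sigma A j.+1], so the correction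
   term in [Acoef] cancels it. *)
have -> : i = n :> nat by apply/eqP; rewrite eqn_leq ige -ltnS ltn_ord.
rewrite eqxx mulr1 /sigma subSS opprK subnSK // addNr.
by rewrite gtn_eqF // subnSK // leq_subr.
Qed.

Lemma cyclic_commute A F F' : F \in unitmx ->
  F *m A = companion A *m F -> F' *m A = companion A *m F' ->
  A *m (invmx F *m F') = (invmx F *m F') *m A.
Proof.
move=> Fu FA F'A; rewrite -mulmxA F'A; apply: (can_inj (mulKmx Fu)).
by rewrite !mulmxA FA mulmxK // mulmxV // mul1mx.
Qed.

End CyclicVectors.

(** * Brackets of operator fields and closed forms *)

Section OperatorFields.
Context {R : realType} {n : nat}.
Local Notation E := 'cV[R]_n.+1.
Local Notation Op := 'M[R]_n.+1.
Local Notation rV := 'rV[R]_n.+1.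
Variables (U : set E).
Hypothesis Uo : open U.
Implicit Types (L M : E -> Op) (alpha : E -> rV) (xi : E -> E).

Let appE L xi u : app L xi u = L u *m xi u. Proof. by []. Qed.

Let derive_app L xi u w : smooth_on U L -> smooth_on U xi -> U u ->
  'D_w (app L xi) u = 'D_w L u *m xi u + L u *m 'D_w xi u.
Proof.
move=> LS xS Uu; have [_ ->] // := is_derive_mulmx (smooth_derivable w LS Uu)
  (smooth_derivable w xS Uu).
Qed.

Let derive_pull alpha L u w : smooth_on U alpha -> smooth_on U L -> U u ->
  'D_w (pull L alpha) u = 'D_w alpha u *m L u + alpha u *m 'D_w L u.
Proof.
move=> aS LS Uu; have [_ ->] // := is_derive_mulmx (smooth_derivable w aS Uu)
  (smooth_derivable w LS Uu).
Qed.

(* Value of [<L, M>(xi, xi)] at [u], for [xi u = v]: the derivatives of [xi]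
   cancel because [L] and [M] commute. *)
Definition bracket_tensor L M (u v : E) : E :=
  L u *m 'D_v M u *m v - M u *m 'D_v L u *m v
  - 'D_(L u *m v) M u *m v + 'D_(M u *m v) L u *m v.

Lemma bracketE L M xi u : smooth_on U L -> smooth_on U M -> smooth_on U xi ->
  U u -> L u *m M u = M u *m L u ->
  bracket L M xi xi u = bracket_tensor L M u (xi u).
Proof.
move=> LS MS xS Uu LM.
rewrite /bracket !appE /lie !appE.
rewrite (derive_app (xi u) LS xS Uu) (derive_app (xi u) MS xS Uu).
rewrite (derive_app (M u *m xi u) LS xS Uu) (derive_app (L u *m xi u) MS xS Uu).
rewrite /bracket_tensor /opmul (subrr ('D_(xi u) xi u)) mulmx0 subr0.
rewrite !(mulmxBr, mulmxDr) !mulmxA LM.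
(* Noncommutative products are generalized to atoms; what remains is a linear identity that [ring]
   decides entrywise. *)
move: (M u *m L u *m _) (M u *m 'D_(L u *m _) xi u) (L u *m 'D_(M u *m _) xi u)
  => x1 x2 x3.
move: (M u *m _ *m _) (L u *m _ *m _) ('D_(L u *m xi u) M u *m xi u)
  ('D_(M u *m xi u) L u *m xi u) => z1 z2 z3 z4.
by apply/matrixP => i j; rewrite !mxE; ring.
Qed.

(** On constant fields [[v, w] = 0] and the other brackets involve only derivatives of [L], so the
    identity for fields becomes a pointwise one. *)
Lemma nijenhuis_const L u v w : nijenhuis U L -> U u ->
  L u *m ('D_w L u *m v) - L u *m ('D_v L u *m w)
  + 'D_(L u *m v) L u *m w - 'D_(L u *m w) L u *m v = 0.
Proof.
move=> [LS LN] Uu.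
have cS (c : E) : smooth_on U (fun=> c : E) by move=> k; exact: Ck_cst.
have := LN _ _ (cS v) (cS w) u Uu.
rewrite !appE /lie !appE.
rewrite (derive_app w LS (cS v) Uu) (derive_app v LS (cS w) Uu).
rewrite (derive_app _ LS (cS v) Uu) (derive_app _ LS (cS w) Uu).
have dc (c z : E) : 'D_z (fun=> c : E) u = 0 by exact: derive_cst.
rewrite (dc w v) (dc v w) (dc w (L u *m v)) (dc v (L u *m w)).
have simp (a b c d : E) (S A : Op) : S *m (0 - 0) - A *m (0 - (a + A *m 0))
    - A *m (b + A *m 0 - 0) + (c + A *m 0 - (d + A *m 0)) =
    A *m a - A *m b + c - d.
  by rewrite subrr !mulmx0 !addr0 !sub0r !subr0 mulmxN opprK addrA.
by move=> <-; apply/esym; exact: simp.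
Qed.

(** The entry (i, j) is the i-th partial derivative of the j-th component, so [J - J^T] is the
    matrix of the 2-form [d alpha]. *)
Definition jacobian_form alpha (u : E) : Op :=
  \matrix_(i, j) 'D_(delta_mx i 0) alpha u 0 j.

Lemma derive_form alpha u v : smooth_on U alpha -> U u ->
  'D_v alpha u = v^T *m jacobian_form alpha u.
Proof.
move=> aS Uu; rewrite (derive_mx_sum v Uo (aS 1%N) Uu).
apply/rowP => j; rewrite summxE mxE; apply: eq_bigr => i _.
by rewrite !mxE.
Qed.

Let trmx11 (x : 'M[R]_1) : x^T = x.
Proof. by apply/matrixP => i j; rewrite mxE !ord1. Qed.

(** Closedness at one point and for arbitrary vectors, so that it can be evaluated on pairs such as
    [L u *m v], [M u *m v]. *)
Definition closed_at alpha (u : E) : Prop :=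
  forall v w : E, 'D_v alpha u *m w = 'D_w alpha u *m v.

Lemma closed_atP alpha : smooth_on U alpha ->
  closed_form U alpha <-> (forall u, U u -> closed_at alpha u).
Proof.
move=> aS; split=> H u Uu.
  have Js : (jacobian_form alpha u)^T = jacobian_form alpha u.
    apply/matrixP => i j; rewrite !mxE.
    have := H u Uu j i.
    have ent k l : 'D_(evec R k) (fun v => alpha v 0 l : R^o) u =
        'D_(delta_mx k 0) alpha u 0 l.
      by have /is_derive_mx/(_ 0 l) [_ ->] := smooth_derivable (delta_mx k 0) aS Uu.
    by rewrite !ent.
  move=> v w; rewrite !derive_form //.
  by rewrite -[LHS]trmx11 !trmx_mul trmxK Js mulmxA.
move=> i j; have /matrixP/(_ 0 0) := H u Uu (delta_mx i 0) (delta_mx j 0).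
have coord (a : rV) l : (a *m delta_mx l 0 : 'M[R]_1) 0 0 = a 0 l.
  by rewrite -colE mxE.
move=> Eij; have {Eij} := etrans (esym (coord _ _)) (etrans Eij (coord _ _)).
have ent k l : 'D_(evec R k) (fun v => alpha v 0 l : R^o) u =
    'D_(delta_mx k 0) alpha u 0 l.
  by have /is_derive_mx/(_ 0 l) [_ ->] := smooth_derivable (delta_mx k 0) aS Uu.
by rewrite !ent.
Qed.

Lemma smooth_pull alpha L : smooth_on U alpha -> smooth_on U L ->
  smooth_on U (pull L alpha).
Proof. exact: smooth_mulmx. Qed.

(* [d(M^* alpha)(L v, v) = - alpha (<L, M>(v, v))]. *)
Lemma d_pull_tensor alpha L M u v :
  smooth_on U alpha -> smooth_on U L -> smooth_on U M -> U u ->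
  (forall x, U x -> L x *m M x = M x *m L x) ->
  closed_at alpha u -> closed_at (pull L alpha) u ->
  'D_(L u *m v) (pull M alpha) u *m v - 'D_v (pull M alpha) u *m (L u *m v)
  = - (alpha u *m bracket_tensor L M u v).
Proof.
move=> aS LS MS Uu LM ca cb.
have H1 := ca (L u *m v) (M u *m v).
have := cb v (M u *m v).
(* Differentiating [L M = M L] along [v] is the only way the commutation near [u], rather than at
   [u], is used. *)
have DLM : 'D_v L u *m M u + L u *m 'D_v M u = 'D_v M u *m L u + M u *m 'D_v L u.
  have [_ <-] := is_derive_mulmx (smooth_derivable v LS Uu)
    (smooth_derivable v MS Uu).
  have [_ <-] := is_derive_mulmx (smooth_derivable v MS Uu)
    (smooth_derivable v LS Uu).
  exact: (derive_near _ Uo Uu LM).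
have {}DLM : 'D_v M u *m L u = 'D_v L u *m M u + L u *m 'D_v M u - M u *m 'D_v L u.
  by rewrite DLM addrK.
rewrite (derive_pull v aS LS Uu) (derive_pull (M u *m v) aS LS Uu).
rewrite (derive_pull v aS MS Uu) (derive_pull (L u *m v) aS MS Uu).
move: H1 DLM (LM u Uu); rewrite /bracket_tensor /pull.
move: ('D_v alpha u) ('D_(L u *m v) alpha u) ('D_(M u *m v) alpha u).
move: ('D_v L u) ('D_v M u) ('D_(L u *m v) M u) ('D_(M u *m v) L u).
move: (alpha u) (L u) (M u) => {LM ca cb} a l m dl dm dm' dl' av alv amv H1 DLM lm H2.
apply: oppr_inj; rewrite opprK opprB.
have -> : (av *m m + a *m dm) *m (l *m v) =
    av *m (m *m l) *m v + a *m (dm *m l) *m v by rewrite mulmxDl !mulmxA.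
have {}H2 : av *m (m *m l) *m v = amv *m (l *m v) + a *m dl' *m v - a *m dl *m m *m v.
  by rewrite -lm; move: H2; rewrite !mulmxDl !mulmxA => <-; rewrite addrK.
rewrite H2 -H1 DLM !(mulmxDl, mulmxDr, mulmxBl, mulmxBr, mulNmx, mulmxN) !mulmxA.
move: (alv *m m *m v) (a *m dl' *m v) (a *m dl *m m *m v) (a *m l *m dm *m v)
  (a *m m *m dl *m v) (a *m dm' *m v) => z1 z2 z3 z4 z5 z6.
by apply/matrixP => i j; rewrite !mxE; ring.
Qed.

(** The claim is a linear combination of four identities: [alpha] closed on [(L v, L w)],
    [L^* alpha] closed on [(L v, w)] and on [(v, L w)], and [alpha] applied to the Nijenhuis
    identity. *)
Lemma closed_pull_nijenhuis alpha L :
  nijenhuis U L -> smooth_on U alpha ->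
  (forall u, U u -> closed_at alpha u) ->
  (forall u, U u -> closed_at (pull L alpha) u) ->
  forall u, U u -> closed_at (pull L (pull L alpha)) u.
Proof.
move=> LN aS ca cb u Uu v w; have [LS _] := LN.
have N0 := nijenhuis_const v w LN Uu.
have H1 := ca u Uu (L u *m v) (L u *m w).
have H2 := cb u Uu (L u *m v) w.
have H3 := cb u Uu v (L u *m w).
have bS := smooth_pull aS LS.
move: H2; rewrite (derive_pull (L u *m v) aS LS Uu) (derive_pull w aS LS Uu) => H2.
move: H3; rewrite (derive_pull v aS LS Uu) (derive_pull (L u *m w) aS LS Uu) => H3.
rewrite (derive_pull v bS LS Uu) (derive_pull w bS LS Uu).
rewrite (derive_pull v aS LS Uu) (derive_pull w aS LS Uu).
move: N0 H1 H2 H3; rewrite /pull.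
move: ('D_v alpha u) ('D_w alpha u) ('D_(L u *m v) alpha u) ('D_(L u *m w) alpha u).
move: ('D_v L u) ('D_w L u) ('D_(L u *m v) L u) ('D_(L u *m w) L u).
move: (alpha u) (L u) => {LN LS ca cb bS} a l dv dw dlv dlw av aw alv alw N0 H1 H2 H3.
have {}N0 : a *m (l *m (dw *m v) - l *m (dv *m w) + dlv *m w - dlw *m v) = 0.
  by rewrite N0 mulmx0.
move: N0 H1 H2 H3;
  rewrite !(mulmxDl, mulmxDr, mulmxBl, mulmxBr, mulNmx, mulmxN) !mulmxA.
move: (alv *m l *m w) (alw *m l *m v) (av *m l *m l *m w) (aw *m l *m l *m v)
  (a *m l *m dw *m v) (a *m l *m dv *m w) (a *m dlv *m w) (a *m dlw *m v)
  (a *m dv *m l *m w) (a *m dw *m l *m v).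
move=> b1 b2 b3 b4 b5 b6 b7 b8 b9 b10 /matrixP N0 /matrixP H1 /matrixP H2 /matrixP H3.
apply/matrixP => i j; move: (N0 i j) (H1 i j) (H2 i j) (H3 i j).
by rewrite !mxE => *; lra.
Qed.

Lemma closed_pull_symmetry alpha L M :
  smooth_on U alpha -> smooth_on U L -> gl_regular U L -> symmetry U L M ->
  (forall u, U u -> closed_at alpha u) ->
  (forall u, U u -> closed_at (pull L alpha) u) ->
  forall u, U u -> closed_at (pull M alpha) u.
Proof.
move=> aS LS Lreg [MS LM Msym] ca cb u Uu.
have tS := smooth_pull aS MS.
set J := jacobian_form (pull M alpha) u.
suff K0 : J - J^T = 0.
  move=> v w; rewrite !derive_form // -/J.
  have {K0} Js : J^T = J by apply/esym/eqP; rewrite -subr_eq0 K0.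
  by rewrite -[LHS]trmx11 !trmx_mul trmxK Js mulmxA.
have [v0 cyc] := Lreg u Uu.
apply: (skew_cyclic_eq0 cyc); first by rewrite raddfB /= trmxK opprB.
move=> a.
(* As the bracket is tensorial, a constant field with value [a] detects its value at [u]. *)
have T0 : bracket_tensor L M u a = 0.
  have cS : smooth_on U (fun=> a : E) by move=> k; exact: Ck_cst.
  by rewrite -(bracketE LS MS cS Uu (LM u Uu)); exact: Msym.
have := d_pull_tensor a aS LS MS Uu LM (ca u Uu) (cb u Uu).
rewrite T0 mulmx0 oppr0 !derive_form // -/J trmx_mul => D0.
rewrite !mulmxBr mulmxBl -[RHS]D0; congr (_ - _); first by rewrite !mulmxA.
by rewrite -[RHS]trmx11 !trmx_mul trmxK !mulmxA.
Qed.

Lemma symmetry_of_closed (f : 'I_n.+1 -> E -> rV) L M :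
  (forall i, smooth_on U (f i)) -> smooth_on U L -> smooth_on U M ->
  (forall x, U x -> L x *m M x = M x *m L x) ->
  (forall u, U u -> row_free (\matrix_i f i u)) ->
  (forall i u, U u -> [/\ closed_at (f i) u, closed_at (pull L (f i)) u &
     closed_at (pull M (f i)) u]) ->
  symmetry U L M.
Proof.
move=> fS LS MS LM frf fc; split=> // xi xS u Uu.
rewrite (bracketE LS MS xS Uu (LM u Uu)).
have Fu : \matrix_i f i u \in unitmx by rewrite -row_free_unit frf.
apply: (can_inj (mulKmx Fu)); rewrite mulmx0.
apply/row_matrixP => i; rewrite row_mul rowK row0.
have [c1 c2 c3] := fc i u Uu.
have := d_pull_tensor (xi u) (fS i) LS MS Uu LM c1 c2.
rewrite (c3 (L u *m xi u) (xi u)).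
move: ('D_(xi u) (pull M (f i)) u *m _) (f i u *m _) => z y.
by rewrite subrr => /esym /eqP; rewrite oppr_eq0 => /eqP.
Qed.

End OperatorFields.

(** * Hierarchies of conservation laws *)

Section Hierarchies.
Context {R : realType} {n : nat}.
Local Notation E := 'cV[R]_n.+1.
Local Notation Op := 'M[R]_n.+1.
Implicit Types (U : set E) (L M : E -> Op).

Lemma smooth_dform U (f : E -> R^o) : open U -> smooth_on U f ->
  smooth_on U (dform f).
Proof.
move=> Uo fS; apply/smooth_mx => // i j.
under eq_fun do rewrite mxE.
exact: smooth_derive.
Qed.

Lemma derive_dform U (f : E -> R^o) u v : open U -> smooth_on U f -> U u ->
  'D_v f u = (dform f u *m v) 0 0.
Proof.
move=> Uo fS Uu; rewrite (derive_grad v Uo (fS 1%N) Uu) mxE.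
by apply: eq_bigr => j _; rewrite mxE mulrC.
Qed.

Lemma is_derive_curve U (f : E -> R^o) (I : set R^o) (c : R^o -> E) x :
  open U -> smooth_on U f -> smooth_on I c -> I x -> U (c x) ->
  is_derive x 1 (f \o c) ((dform f (c x) *m derive1 c x) 0 0).
Proof.
move=> Uo fS cS Ix Ucx.
have fd := smooth_differentiable Uo fS Ucx.
have := is_derive_comp fd (smooth_derivable (1 : R^o) cS Ix).
by rewrite -deriveE // (derive_dform _ Uo fS Ucx) derive1E.
Qed.

Lemma closed_dform U (f : E -> R^o) : open U -> smooth_on U f ->
  closed_form U (dform f).
Proof.
move=> Uo fS u Uu i j.
under eq_fun do rewrite mxE.
under [in RHS]eq_fun do rewrite mxE.
exact: (derive_comm _ _ Uo (fS 2%N)).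
Qed.

Lemma closed_at_ext U (alpha beta : E -> 'rV[R]_n.+1) u : open U -> U u ->
  (forall x, U x -> alpha x = beta x) -> closed_at alpha u -> closed_at beta u.
Proof.
move=> Uo Uu ab ca v w.
by rewrite -!(derive_near _ Uo Uu ab).
Qed.

Definition frame (f : 'I_n.+1 -> E -> R^o) (u : E) : Op :=
  \matrix_(i < n.+1) dform (f i) u.

Lemma smooth_frame U f : open U -> (forall i, smooth_on U (f i)) ->
  smooth_on U (frame f).
Proof.
move=> Uo fS; apply/smooth_mx => // i j.
under eq_fun do rewrite !mxE.
exact: smooth_derive.
Qed.

Section OneHierarchy.
Variables (U : set E) (L : E -> Op) (f : 'I_n.+1 -> E -> R^o).
Hypotheses (Uo : open U) (LN : nijenhuis U L) (fH : regular_hierarchy U L f).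

Lemma hierarchy_smooth i : smooth_on U (f i).
Proof. by case: fH => -[]. Qed.

Lemma frame_unit u : U u -> frame f u \in unitmx.
Proof. by move=> Uu; rewrite -row_free_unit; case: fH => _; apply. Qed.

Lemma hierarchy_power i u : U u -> dform (f i) u = dform (f 0) u *m L u ^+ i.
Proof.
move=> Uu; case: i => i; elim: i => [|i IH] ilt.
  by rewrite expr0 mulmx1; congr (dform (f _) u); apply: val_inj.
have [[_ _ step] _] := fH.
rewrite -(step (Ordinal (ltnW ilt)) (Ordinal ilt) erefl u Uu) /pull IH /=.
by rewrite exprSr -mulmxE mulmxA.
Qed.

Lemma frame_companion u : U u ->
  frame f u *m L u = companion (L u) *m frame f u.
Proof.
by move=> Uu; apply: companionP => i; rewrite !rowK hierarchy_power.
Qed.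

(** The form [L^* df_i] is [df_(i+1)] except for the last index, where only the Nijenhuis property
    gives closedness, through [df_i = L^* df_(i-1)]. That argument serves every index but the first,
    which is covered by the definition of a hierarchy. *)
Lemma hierarchy_closed i u : U u ->
  closed_at (dform (f i)) u /\ closed_at (pull L (dform (f i))) u.
Proof.
have dS j := smooth_dform Uo (hierarchy_smooth j).
have cl j x : U x -> closed_at (dform (f j)) x.
  exact: (closed_atP Uo (dS j)).1 (closed_dform Uo (hierarchy_smooth j)) x.
have [LS _] := LN; have [[[_ c0] _ step] _] := fH.
move=> Uu; split; first exact: cl.
case: i => -[|i] ilt.
  have -> : Ordinal ilt = ord0 by apply: val_inj.
  exact: (closed_atP Uo (smooth_pull Uo (dS ord0) LS)).1 c0 u Uu.
pose i' : 'I_n.+1 := Ordinal (ltnW ilt).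
have st := step i' (Ordinal ilt) erefl.
have cp x : U x -> closed_at (pull L (dform (f i'))) x.
  move=> Ux; apply: closed_at_ext Uo Ux _ (cl (Ordinal ilt) x Ux) => y Uy.
  by rewrite st.
apply: closed_at_ext Uo Uu _
  (closed_pull_nijenhuis Uo LN (dS i') (cl i') cp Uu) => y Uy.
exact: (congr1 (fun a => a *m L y) (st y Uy)).
Qed.

End OneHierarchy.

Lemma xi_spec_frame (f : 'I_n.+1 -> E -> R^o) pt v :
  xi_spec f pt v <-> frame f pt *m v = delta_mx ord_max 0.
Proof.
have ent i : (frame f pt *m v) i 0 = (dform (f i) pt *m v) 0 0.
  by rewrite !mxE; apply: eq_bigr => k _; rewrite !mxE.
split=> [[H0 H1]|H].
  apply/matrixP => i j; rewrite (ord1 j) ent [RHS]mxE eqxx andbT.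
  have [ilt|ige] := ltnP i n.
    by rewrite H0 // mxE -val_eqE /= (ltn_eqF ilt).
  have -> : i = ord_max by apply: val_inj; apply/eqP; rewrite eqn_leq ige -ltnS ltn_ord.
  by rewrite H1 mxE !eqxx.
split=> [i ilt|]; apply/matrixP => a b; rewrite !ord1 -ent H !mxE eqxx andbT.
  by rewrite -val_eqE /= (ltn_eqF ilt).
by rewrite eqxx.
Qed.

End Hierarchies.

(** * The hodograph solution *)

Section Hodograph.
Context {R : realType} {n : nat}.
Local Notation E := 'cV[R]_n.+1.
Local Notation Op := 'M[R]_n.+1.
Variables (U : set E) (p : E) (L : E -> Op) (I : set R^o) (gamma : R^o -> E).
Variable g : 'I_n.+1 -> E -> R^o.
Hypotheses (Uo : open U) (Up : U p) (Io : open I) (I0 : I 0).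
Hypotheses (gammaS : smooth_on I gamma).
Hypotheses (gammaU : forall x, I x -> U (gamma x)) (gamma0 : gamma 0 = p).
Hypothesis gH : regular_hierarchy U L g.
Hypothesis gN : forall x, I x -> normalized_at g gamma x.

Let gS i : smooth_on U (g i). Proof. exact: hierarchy_smooth gH i. Qed.

Let gamma_continuous x : I x -> {for x, continuous gamma}.
Proof. exact: smooth_continuous. Qed.

Lemma near_gamma (A : set E) : open A -> A p -> \forall x \near (0 : R^o), A (gamma x).
Proof.
move=> Ao Ap; have := gamma_continuous I0.
by rewrite /prop_for /continuous_at gamma0; apply; exact: open_nbhs_nbhs.
Qed.

(** Differentiating the normalization of [g] along the curve shows that [gamma'] is the vector dual
    to [dg_N]. *)
Lemma frame_gamma x : I x ->
  frame g (gamma x) *m derive1 gamma x = delta_mx ord_max 0.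
Proof.
move=> Ix; apply/xi_spec_frame.
have D i : 'D_1 (g i \o gamma) x = (dform (g i) (gamma x) *m derive1 gamma x) 0 0.
  by have [_ ->] := is_derive_curve Uo (gS i) gammaS Ix (gammaU Ix).
split=> [i ilt|]; apply/matrixP => a b; rewrite !ord1 -D.
  have gi y : I y -> cst (0 : R^o) y = (g i \o gamma) y.
    by move=> Iy /=; have [_ /(_ i ilt) ->] := gN Iy.
  by rewrite -(derive_near (1 : R^o) Io Ix gi) derive_cst mxE.
have gi y : I y -> id y = (g ord_max \o gamma) y.
  by move=> Iy /=; have [-> _] := gN Iy.
by rewrite -(derive_near (1 : R^o) Io Ix gi) derive_id mxE.
Qed.

(** The reversal puts [g_N] into slot 0, the slot of [x], so that the hodograph equations read
    [Gv v = y]. *)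
Let Gv (v : E) : E := \col_i g (rev_ord i) v.

Let hodographE y v : hodograph g y v <-> Gv v = y.
Proof.
split=> [H|<- i]; last by rewrite mxE rev_ordK.
by apply/matrixP => i j; rewrite (ord1 j) mxE H rev_ordK.
Qed.

Let GvS : smooth_on U Gv.
Proof.
apply/smooth_mx => // i j; under eq_fun do rewrite mxE.
exact: gS.
Qed.

Let jacE v i j : jac Gv v i j = frame g v (rev_ord i) j.
Proof. by rewrite !mxE; under eq_fun do rewrite mxE. Qed.

Let jac_unit v : U v -> jac Gv v \in unitmx.
Proof.
move=> Uv.
have -> : jac Gv v = row_perm (perm (@rev_ord_inj n.+1)) (frame g v).
  by apply/matrixP => i j; rewrite jacE [RHS]mxE permE.
by rewrite row_permE unitmx_mul unitmx_perm (frame_unit gH).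
Qed.

Lemma hodograph_solution : exists W V : set E,
  [/\ open W, W 0, open V, V p & V `<=` U] /\
  (forall y, W y -> exists! v, V v /\ hodograph g y v) /\
  (forall u : E -> E, (forall y, W y -> V (u y) /\ hodograph g y (u y)) ->
    solves_system W U L u /\
    (\forall x \near (0 : R^o), u (x *: evec R ord0) = gamma x)).
Proof.
have hodo_gamma x : I x -> hodograph g (x *: evec R ord0) (gamma x).
  move=> Ix i; rewrite !mxE eqxx andbT.
  have [gn gi] := gN Ix.
  have [ilt|ige] := ltnP i n.
    by rewrite gi // -val_eqE /= subSS subn_eq0 leqNgt ilt mulr0.
  have -> : i = ord_max by apply: val_inj; apply/eqP; rewrite eqn_leq ige -ltnS ltn_ord.
  by rewrite gn -val_eqE /= subnn mulr1.
have Gp : Gv p = 0.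
  by apply/hodographE; rewrite -gamma0 -[X in hodograph g X](scale0r (evec R ord0));
    exact: hodo_gamma.
have [W [V [[Wo W0 Vo Vp VU] [exu sol]]]] := inverse_function Uo Up GvS jac_unit.
rewrite Gp in W0.
exists W, V; split=> //; split.
  move=> y /exu [v [[Vv Gvy] uniq]]; exists v; split.
    by split=> //; apply/hodographE.
  by move=> w [Vw /hodographE Gw]; exact: uniq.
move=> u uP; have uP' y : W y -> V (u y) /\ Gv (u y) = y.
  by move=> /uP [Vu /hodographE].
have [uS uD] := sol u uP'.
split.
  split=> // [y /uP [/VU]//|y Wy i _].
  have Uu : U (u y) by have [/VU] := uP y Wy.
  have ilen : (i <= n)%N by rewrite -ltnS ltn_ord.
  have inord0 : inord 0 = ord0 :> 'I_n.+1 by apply: val_inj; rewrite /= inordK.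
  (* The derivative of [u] along the k-th variable is [invmx (jac Gv (u y))] applied to the k-th
     basis vector; undoing the reversal, it is dual to [dg_(N-k)], as the chain requires. [inord]
     extends the family to natural indices. *)
  have := companion_chain (F := frame g (u y))
    (w := fun k => 'D_(evec R (inord k)) u y)
    (frame_unit gH Uu) (frame_companion gH Uu) _ ilen.
  rewrite inord_val inord0; apply.
  move=> j jn; apply/matrixP => a b; rewrite (ord1 b).
  have -> : (frame g (u y) *m 'D_(evec R (inord j)) u y) a 0 =
      (jac Gv (u y) *m 'D_(evec R (inord j)) u y) (rev_ord a) 0.
    by rewrite !mxE; apply: eq_bigr => k _; rewrite jacE rev_ordK.
  rewrite uD // mulKVmx ?jac_unit // !mxE !eqxx !andbT -!val_eqE /=.
  rewrite !inordK ?ltnS ?leq_subr // subSS.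
  congr (nat_of_bool _)%:R.
  by apply/eqP/eqP => [<-|->]; rewrite subKn // -ltnS ltn_ord.
(* The initial condition follows from uniqueness: for small [x] both [gamma x] and
   [u (x *: evec R ord0)] lie in [V] and solve the same equations. *)
have nW : \forall x \near (0 : R^o), W (x *: evec R ord0).
  pose e0 : E := evec R ord0.
  have : (x *: e0) @[x --> (0 : R)] --> (0 : R) *: e0 by exact: scalel_continuous.
  by rewrite scale0r; apply; exact: open_nbhs_nbhs.
have nI : \forall x \near (0 : R^o), I x by exact: open_nbhs_nbhs.
apply: filterS3 nW nI (near_gamma Vo Vp) => x Wx Ix Vx.
have [v [_ uniq]] := exu _ Wx.
rewrite -(uniq _ (uP' _ Wx)); apply: uniq; split=> //.
exact/hodographE/hodo_gamma.
Qed.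

End Hodograph.

(** * Hierarchies from symmetries *)

Section Symmetries.
Context {R : realType} {n : nat}.
Local Notation E := 'cV[R]_n.+1.
Local Notation Op := 'M[R]_n.+1.

Lemma closed_form_ext (W : set E) (alpha beta : E -> 'rV[R]_n.+1) : open W ->
  (forall x, W x -> alpha x = beta x) -> closed_form W alpha -> closed_form W beta.
Proof.
move=> Wo ab ca u Wu i j.
have ent k x : W x -> (alpha x 0 k : R^o) = beta x 0 k by move=> /ab ->.
rewrite -(derive_near (evec R i) Wo Wu (ent j)).
by rewrite -(derive_near (evec R j) Wo Wu (ent i)); exact: ca.
Qed.

Lemma smooth_locally_bounded (V : set E) (p : E) m q (alpha : E -> 'M[R]_(m, q)) :
  open V -> V p -> smooth_on V alpha ->
  exists K, \forall x \near p, `|alpha x| <= K.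
Proof.
move=> Vo Vp aS; exists (`|alpha p| + 1).
have /cvgrPdist_le/(_ _ ltr01) := smooth_continuous aS Vp.
apply: filterS => x ax; rewrite -[alpha x](subrK (alpha p)) addrC.
by apply: le_trans (ler_normD _ _) _; rewrite lerD2l distrC.
Qed.

(** Provides, on a small enough ball, the constant that the Poincare lemma needs to dominate the
    integrand. *)
Lemma form_locally_bounded (V : set E) (p : E) (alpha : E -> 'rV[R]_n.+1) :
  open V -> V p -> smooth_on V alpha ->
  exists K, \forall x \near p, `|alpha x| <= K /\
    forall j, `|'D_(delta_mx j 0) alpha x| <= K.
Proof.
move=> Vo Vp aS.
have [K0 H0] := smooth_locally_bounded Vo Vp aS.
have /choice [K1 H1] (j : 'I_n.+1) :=
  smooth_locally_bounded Vo Vp (smooth_derive (delta_mx j 0) aS).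
exists (`|K0| + \sum_j `|K1 j|).
apply: filterS2 H0 (filter_forall _ H1) => x ax dax; split.
  rewrite (le_trans ax) // (le_trans (ler_norm _)) // lerDl.
  by apply: sumr_ge0.
move=> j; rewrite (le_trans (dax j)) // (le_trans (ler_norm _)) //.
rewrite (bigD1 j) //= addrCA lerDl addr_ge0 //.
by apply: sumr_ge0.
Qed.

Lemma dform_ball_inj (p : E) (r : R) (h h' : E -> R^o) : 0 < r ->
  smooth_on (ball p r) h -> smooth_on (ball p r) h' -> h p = h' p ->
  (forall v, ball p r v -> dform h v = dform h' v) ->
  forall v, ball p r v -> h v = h' v.
Proof.
move=> r0 hS h'S hp hd v Bv.
have Bo : open (ball p r) by exact: ball_open.
have := @eq_of_zero_derive R _ (fun x => h x - h' x : R^o) p (v - p) _.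
rewrite (addrC p) subrK hp subrr => H; apply/eqP; rewrite -subr_eq0; apply/eqP.
apply: H => t t01.
have Bt : ball p r (p + t *: (v - p)).
  by apply: ball_segment => //; exact: ballxx.
have D1 := smooth_derivable (v - p) hS Bt.
have D2 := smooth_derivable (v - p) h'S Bt.
have := is_deriveB D1 D2.
rewrite (derive_dform _ Bo hS Bt) (derive_dform _ Bo h'S Bt) hd //.
by rewrite subrr.
Qed.

Variables (U : set E) (p : E) (L : E -> Op) (I : set R^o) (gamma : R^o -> E).
Variables f g : 'I_n.+1 -> E -> R^o.
Hypotheses (Uo : open U) (Up : U p) (LN : nijenhuis U L).
Hypotheses (Lreg : gl_regular U L) (Io : open I) (I0 : I 0).
Hypotheses (gammaS : smooth_on I gamma).
Hypotheses (gammaU : forall x, I x -> U (gamma x)) (gamma0 : gamma 0 = p).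
Hypothesis gammaC :
  forall x, I x -> cyclic_vector (L (gamma x)) (derive1 gamma x).
Hypothesis gH : regular_hierarchy U L g.
Hypothesis gN : forall x, I x -> normalized_at g gamma x.
Hypothesis fH : regular_hierarchy U L f.

Let LS : smooth_on U L. Proof. by case: LN. Qed.
Let fS i : smooth_on U (f i). Proof. exact: hierarchy_smooth fH i. Qed.
Let gS i : smooth_on U (g i). Proof. exact: hierarchy_smooth gH i. Qed.

Lemma xi_exists_unique x : I x -> exists! v, xi_spec f (gamma x) v.
Proof.
move=> Ix; have Fu := frame_unit fH (gammaU Ix).
exists (invmx (frame f (gamma x)) *m delta_mx ord_max 0); split.
  by apply/xi_spec_frame; rewrite mulKVmx.
by move=> v /xi_spec_frame <-; rewrite mulKmx.
Qed.

(* Both frames intertwine [L] with the same companion matrix, so this operator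
   commutes with [L]; it carries [dform (f i)] to [dform (g i)]. *)
Definition transition (u : E) : Op := invmx (frame f u) *m frame g u.

Lemma frame_transition u : U u -> frame f u *m transition u = frame g u.
Proof. by move=> Uu; rewrite mulKVmx // (frame_unit fH Uu). Qed.

Lemma pull_transition i u : U u -> pull transition (dform (f i)) u = dform (g i) u.
Proof.
move=> Uu; have := congr1 (row i) (frame_transition Uu).
by rewrite row_mul !rowK.
Qed.

Lemma transition_smooth : smooth_on U transition.
Proof.
apply: smooth_mulmx => //; last exact: smooth_frame.
by apply: smooth_invmx => //; [exact: frame_unit fH|exact: smooth_frame].
Qed.

Lemma transition_commute u : U u -> L u *m transition u = transition u *m L u.
Proof.
move=> Uu; apply: cyclic_commute; first exact: frame_unit fH _ Uu.
  exact: frame_companion fH _ Uu.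
exact: frame_companion gH _ Uu.
Qed.

Lemma transition_symmetry : symmetry U L transition.
Proof.
apply: (symmetry_of_closed Uo (f := fun i => dform (f i))) => //.
- by move=> i; exact: smooth_dform.
- exact: transition_smooth.
- exact: transition_commute.
- by case: fH.
move=> i u Uu; have [c1 c2] := hierarchy_closed Uo LN fH i Uu.
split; [exact: c1|exact: c2|].
have [c3 _] := hierarchy_closed Uo LN gH i Uu.
by apply: closed_at_ext Uo Uu _ c3 => x Ux; rewrite pull_transition.
Qed.

(** Both operators commute with [L] and send [gamma'] to [xi]: for the transition, [F xi] and
    [G gamma'] are the same last basis vector. Cyclicity of [gamma'] then leaves only one such
    operator. *)
Lemma transition_Mhat x xi M : I x -> xi_spec f (gamma x) xi ->
  Mhat_spec (L (gamma x)) (derive1 gamma x) xi M -> M = transition (gamma x).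
Proof.
move=> Ix /xi_spec_frame fxi MP; have Ux := gammaU Ix.
have [B [_ uniq]] := commutant_cyclic xi (gammaC Ix).
rewrite -(uniq _ MP); apply: uniq; split.
  by rewrite transition_commute.
apply: (can_inj (mulKmx (frame_unit fH Ux))).
by rewrite mulmxA frame_transition // fxi; exact: (frame_gamma Uo _ _ _ gH gN).
Qed.

Section Converse.
Variables (xi : R^o -> E) (Mhat : R^o -> Op) (V : set E) (M : E -> Op).
Hypothesis xiP : forall x, I x -> xi_spec f (gamma x) (xi x).
Hypothesis MhatP :
  forall x, I x -> Mhat_spec (L (gamma x)) (derive1 gamma x) (xi x) (Mhat x).
Hypotheses (Vo : open V) (Vp : V p) (VU : V `<=` U) (Msym : symmetry V L M).
Hypothesis Mgamma : \forall x \near (0 : R^o), M (gamma x) = Mhat x.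

Local Notation theta i := (pull M (dform (f i))).

Let MS : smooth_on V M. Proof. by case: Msym. Qed.
Let LSV : smooth_on V L. Proof. exact: smooth_subset VU LS. Qed.
Let LregV : gl_regular V L. Proof. by move=> u /VU; exact: Lreg. Qed.
Let dfS i : smooth_on V (dform (f i)).
Proof. by apply: smooth_subset VU _; exact: smooth_dform. Qed.
Let thetaS i : smooth_on V (theta i). Proof. exact: smooth_pull. Qed.

Let theta_closed i u : V u -> closed_at (theta i) u.
Proof.
apply: (closed_pull_symmetry Vo (dfS i) LSV LregV Msym) => x /VU Ux;
  by have [] := hierarchy_closed Uo LN fH i Ux.
Qed.

Lemma symmetry_pull_closed i : closed_form V (theta i).
Proof. exact: (closed_atP Vo (thetaS i)).2 (@theta_closed i). Qed.

(** Because [L] and [M] commute, this is [M^*] applied to [L^* df_i]. The latter is closed together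
    with its own pullback by [L], so the closedness criterion for symmetries applies to it. *)
Let pull_L_theta_closed i : closed_form V (pull L (theta i)).
Proof.
have bS := smooth_pull Vo (dfS i) LSV.
have dS := smooth_dform Uo (fS i).
have c1 x : U x -> closed_at (dform (f i)) x.
  by move=> Ux; have [] := hierarchy_closed Uo LN fH i Ux.
have c2 x : U x -> closed_at (pull L (dform (f i))) x.
  by move=> Ux; have [] := hierarchy_closed Uo LN fH i Ux.
have c3 := closed_pull_nijenhuis Uo LN dS c1 c2.
have cl : closed_form V (pull M (pull L (dform (f i)))).
  apply: (closed_atP Vo (smooth_pull Vo bS MS)).2.
  by apply: (closed_pull_symmetry Vo bS LSV LregV Msym) => x /VU; [exact: c2|exact: c3].
apply: closed_form_ext Vo _ cl => x Vx.
by rewrite /pull -!mulmxA; case: Msym => _ -> .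
Qed.

(** At [p] the symmetry coincides with the quotient of two invertible frames. By continuity of the
    determinant it stays invertible nearby, which makes the new hierarchy regular. *)
Let Mp_unit : M p \in unitmx.
Proof.
have -> : M p = Mhat 0 by rewrite -gamma0; exact: nbhs_singleton Mgamma.
rewrite (transition_Mhat I0 (xiP I0) (MhatP I0)) gamma0 unitmx_mul unitmx_inv.
by rewrite (frame_unit fH Up) (frame_unit gH Up).
Qed.

Lemma hierarchy_of_symmetry :
  exists (W : set E) (h : 'I_n.+1 -> E -> R^o),
    [/\ open W, W p & W `<=` V] /\
    (forall i, smooth_on W (h i) /\ h i p = 0 /\
       forall v, W v -> dform (h i) v = theta i v) /\
    (forall h' : 'I_n.+1 -> E -> R^o,
       (forall i, smooth_on W (h' i) /\ h' i p = 0 /\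
          forall v, W v -> dform (h' i) v = theta i v) ->
       forall i v, W v -> h' i v = h i v) /\
    regular_hierarchy W L h /\
    (\forall x \near (0 : R^o), normalized_at h gamma x).
Proof.
have /choice [K HK] (i : 'I_n.+1) := form_locally_bounded Vo Vp (thetaS i).
have nV : \forall x \near p, V x by exact: open_nbhs_nbhs.
have nM : \forall x \near p, M x \in unitmx.
  have dC := Ck_continuous (Ck_det Vo (MS 0%N)) Vp.
  have d0 : \det (M p) != 0 by rewrite -unitfE -unitmxE.
  apply: filterS (cvgr_neq0 _ dC d0) => x.
  by rewrite unitmxE unitfE.
have [r /= r0 Br] := (nbhs_ballP _ _).1 (filterI nV (filterI nM (filter_forall _ HK))).
pose W := ball p r; pose h i := radial_primitive p (theta i).
have Wo : open W by exact: ball_open.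
have Wp : W p by exact: ballxx.
have WV : W `<=` V by move=> x /Br [].
have thW i : smooth_on W (theta i) by exact: smooth_subset WV _.
have hD i v w : W v -> is_derive v w (h i) ((theta i v *m w) 0 0).
  apply: (is_derive_radial_primitive (K := K i)) => //.
  - by move=> x a b /WV Vx; exact: theta_closed.
  - by move=> x /Br [_ [_ /(_ i) []]].
  - by move=> x j /Br [_ [_ /(_ i) [_]]]; apply.
have hS i : smooth_on W (h i).
  apply: (radial_primitive_smooth (K := K i)) => //.
  - by move=> x a b /WV Vx; exact: theta_closed.
  - by move=> x /Br [_ [_ /(_ i) []]].
  - by move=> x j /Br [_ [_ /(_ i) [_]]]; apply.
have h0 i : h i p = 0 by exact: radial_primitive0.
have hd i v : W v -> dform (h i) v = theta i v.
  move=> Wv; apply/rowP => j; rewrite mxE.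
  have [_ ->] := hD i v (evec R j) Wv.
  by rewrite -colE mxE.
(* From here on only smoothness, the value at [p] and the differential of [h i] matter, not the
   integral formula. *)
clearbody h.
exists W, h; split; first by split.
split; first by move=> i; split; [exact: hS|split; [exact: h0|exact: hd]].
split.
  move=> h' h'P i v Wv; have [h'S [h'0 h'd]] := h'P i.
  apply: (dform_ball_inj r0 h'S (hS i)) => //; first by rewrite h'0 h0.
  by move=> x Wx; rewrite h'd // hd.
split.
  split.
    split; [|exact: hS|].
    - split; first exact: hS.
      apply: closed_form_ext Wo _ _ => [x Wx|]; last first.
        by move=> u /WV; exact: pull_L_theta_closed ord0 u.
      by rewrite /pull hd.
    - move=> i j ij u Wu; rewrite /pull (hd i u Wu) (hd j u Wu).
      have [[_ _ step] _] := fH; have Uu := VU (WV _ Wu).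
      rewrite /pull -(step i j ij u Uu) /pull -!mulmxA.
      by have [_ LM _] := Msym; rewrite (LM u (WV _ Wu)).
  move=> u Wu; have -> : \matrix_(i < n.+1) dform (h i) u = frame f u *m M u.
    by apply/row_matrixP => i; rewrite row_mul !rowK hd.
  rewrite row_free_unit unitmx_mul (frame_unit fH (VU (WV _ Wu))).
  by have [_ []] := Br _ Wu.
have nW := near_gamma I0 gammaS gamma0 Wo Wp.
have nI : \forall x \near (0 : R^o), I x by exact: open_nbhs_nbhs.
have [d /= d0 Hd] := (nbhs_ballP _ _).1 (filterI nI (filterI nW Mgamma)).
(* Along the curve [dh_i(gamma') = df_i(M gamma') = df_i(xi)], which is 1 for the last index and 0
   otherwise. *)
have dh i (x : R^o) : `|x| < d -> is_derive x (1 : R^o) (h i \o gamma)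
    ((i == ord_max)%:R : R^o).
  move=> xd; have Bx : ball (0 : R^o) d x by rewrite -ball_normE /= sub0r normrN.
  have [Ix [/= Wx Mx]] := Hd x Bx.
  have := is_derive_curve Wo (hS i) gammaS Ix Wx.
  rewrite hd // /pull Mx -mulmxA; have [_ ->] := MhatP Ix.
  have /xi_spec_frame/(congr1 (row i)) := xiP Ix.
  rewrite row_mul rowK => ->; by rewrite !mxE eqxx andbT.
(* The difference of the two sides vanishes at 0, where [gamma 0 = p], and has zero derivative
   between 0 and [x]. *)
have hx i (x : R^o) : `|x| < d -> h i (gamma x) = x * (i == ord_max)%:R.
  move=> xd.
  have := @eq_of_zero_derive R R^o
    (fun y => h i (gamma y) - y * (i == ord_max)%:R : R^o) 0 x _.
  rewrite add0r gamma0 h0 mul0r subrr => H; apply/eqP; rewrite -subr_eq0.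
  apply/eqP; apply: H => t /andP[t0 t1].
  have td : `|0 + t *: (x : R^o)| < d.
    rewrite add0r normrZ ger0_norm //; apply: le_lt_trans xd.
    by rewrite ler_piMl.
  have D1 := dh i _ td.
  have D2 := is_derive_mulr (is_derive_id (0 + t *: (x : R^o)) (1 : R^o))
    (is_derive_cst ((i == ord_max)%:R : R^o) (0 + t *: (x : R^o)) (1 : R^o)).
  have D3 := is_deriveB D1 D2.
  have := is_derive_scale x D3; rewrite [x *: (1 : R^o)]mulr1.
  by rewrite mul1r mulr0 addr0 subrr scaler0.
apply/nbhs_ballP; exists d => // x; rewrite -ball_normE /= sub0r normrN => xd.
split; first by rewrite hx // eqxx mulr1.
by move=> i ilt; rewrite hx // -val_eqE /= (ltn_eqF ilt) mulr0.
Qed.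

End Converse.
End Symmetries.

(** In (b) existence yields a symmetry on all of [U], whereas the procedure is run with any symmetry
    near [p] that agrees with [Mhat] for small [x]; hence the smaller domain [W] and a normalization
    asserted for small [x]. *)
Theorem theorem1p7 (R : realType) (n : nat)
    (U : set 'cV[R]_n.+1) (p : 'cV[R]_n.+1) (L : 'cV[R]_n.+1 -> 'M[R]_n.+1)
    (I : set R^o) (gamma : R^o -> 'cV[R]_n.+1)
    (g : 'I_n.+1 -> 'cV[R]_n.+1 -> R^o)
    (Uopen : open U) (Up : U p)
    (LNij : nijenhuis U L) (Lreg : gl_regular U L)
    (Iopen : open I) (I0 : I 0)
    (gammaS : smooth_on I gamma)
    (gammaU : forall x, I x -> U (gamma x))
    (gamma0 : gamma 0 = p)
    (gammaC : forall x, I x -> cyclic_vector (L (gamma x)) (derive1 gamma x))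
    (gH : regular_hierarchy U L g)
    (gN : forall x, I x -> normalized_at g gamma x) :
  (* (a) *)
  (exists W V : set 'cV[R]_n.+1,
    [/\ open W, W 0, open V, V p & V `<=` U] /\
    (forall y, W y -> exists! v, V v /\ hodograph g y v) /\
    (forall u : 'cV[R]_n.+1 -> 'cV[R]_n.+1,
      (forall y, W y -> V (u y) /\ hodograph g y (u y)) ->
      solves_system W U L u /\
      (\forall x \near (0 : R^o), u (x *: evec R ord0) = gamma x)))
  /\
  (* (b) *)
  (forall f : 'I_n.+1 -> 'cV[R]_n.+1 -> R^o, regular_hierarchy U L f ->
    (forall x, I x -> exists! v, xi_spec f (gamma x) v) /\
    (forall x v, I x -> xi_spec f (gamma x) v ->
      exists! B, Mhat_spec (L (gamma x)) (derive1 gamma x) v B) /\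
    (forall (xi : R^o -> 'cV[R]_n.+1) (Mhat : R^o -> 'M[R]_n.+1),
      (forall x, I x -> xi_spec f (gamma x) (xi x)) ->
      (forall x, I x ->
        Mhat_spec (L (gamma x)) (derive1 gamma x) (xi x) (Mhat x)) ->
      (exists M, symmetry U L M /\ forall x, I x -> M (gamma x) = Mhat x) /\
      (forall (V : set 'cV[R]_n.+1) (M : 'cV[R]_n.+1 -> 'M[R]_n.+1),
        open V -> V p -> V `<=` U -> symmetry V L M ->
        (\forall x \near (0 : R^o), M (gamma x) = Mhat x) ->
        (forall i, closed_form V (pull M (dform (f i)))) /\
        exists (W : set 'cV[R]_n.+1)
               (h : 'I_n.+1 -> 'cV[R]_n.+1 -> R^o),
          [/\ open W, W p & W `<=` V] /\
          (forall i, smooth_on W (h i) /\ h i p = 0 /\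
             forall v, W v -> dform (h i) v = pull M (dform (f i)) v) /\
          (forall h' : 'I_n.+1 -> 'cV[R]_n.+1 -> R^o,
             (forall i, smooth_on W (h' i) /\ h' i p = 0 /\
                forall v, W v -> dform (h' i) v = pull M (dform (f i)) v) ->
             forall i v, W v -> h' i v = h i v) /\
          regular_hierarchy W L h /\
          (\forall x \near (0 : R^o), normalized_at h gamma x)))).
Proof.
split; first exact: (hodograph_solution Uopen Up Iopen I0 gammaS gamma0 gH gN).
move=> f fH; split.
  by move=> x Ix; exact: (xi_exists_unique gammaU fH Ix).
split.
  by move=> x v Ix _; exact: commutant_cyclic (gammaC x Ix).
move=> xi Mhat xiP MhatP; split.
  (* The assumed normalized hierarchy [g] supplies the witness, so the symmetry exists wherever both
     frames are defined. *)
  exists (transition f g); split; first exact: transition_symmetry.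
  move=> x Ix; apply/esym.
  exact: (transition_Mhat Uopen Iopen gammaS gammaU gammaC gH gN fH Ix (xiP x Ix)
    (MhatP x Ix)).
move=> V M Vo Vp VU Msym Mgamma; split.
  exact: (symmetry_pull_closed Uopen LNij Lreg fH Vo VU Msym).
exact: (hierarchy_of_symmetry Uopen Up LNij Lreg Iopen I0 gammaS gammaU gamma0
  gammaC gH gN fH xiP MhatP Vo Vp VU Msym Mgamma).
Qed.
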